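(* Let $\mathcal{R}_0$ be an LCSTRS which is AFP as witnessed by a sort ordering $\succsim$, and let $H$ be a set of hidden symbols of $\mathcal{R}_0$. Suppose that for each public extension $\mathcal{R}_1$ of $\mathcal{R}_0$ and each sort ordering $\succsim'$ on the sorts of $\mathcal{R}_0\cup\mathcal{R}_1$ that coincides with $\succsim$ on the sorts of $\mathcal{R}_0$, there exists no infinite computable $(\mathrm{SDP}(\mathcal{R}_0),\mathcal{R}_0\cup\mathcal{R}_1)$-chain that is public (computability being taken in $\mathcal{R}_0\cup\mathcal{R}_1$ with $\succsim'$). Then $\mathcal{R}_0$ is publicly computable with respect to $H$.
   Context: LCSTRSs. Fix sorts $\mathcal{S}$ with theory sorts $\mathcal{S}_{\mathrm{th}}$; types $\mathcal{T}::=\mathcal{S}\mid(\mathcal{T}\to\mathcal{T})$; theory types $\mathcal{T}_{\mathrm{th}}::=\mathcal{S}_{\mathrm{th}}\mid(\mathcal{S}_{\mathrm{th}}\to\mathcal{T}_{\mathrm{th}})$. Terms are well-typed applicative expressions over typed function symbols $\mathcal{F}$ and variables $\mathcal{V}$ (infinitely many per type); $\mathrm{FV}(t)$ is the set of variables; ground means no variables. Theory symbols $\mathcal{F}_{\mathrm{th}}\subseteq\mathcal{F}$ have theory types; those of sort type are values; theory terms are built from theory symbols and variables. Each theory sort $A$ has a set $\mathfrak{X}_A$; an interpretation $[\![\cdot]\!]$ of theory symbols (bijective on values of each theory sort) extends to ground theory terms by $[\![t_0\,t_1]\!]=[\![t_0]\!]([\![t_1]\!])$; $\mathsf{bool}\in\mathcal{S}_{\mathrm{th}}$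 with values $\mathfrak{t},\mathfrak{f}$ interpreted as $1,0$. A logical constraint is a $\mathsf{bool}$-typed theory term with theory-sorted variables. Substitutions are type-preserving; contexts have one hole. A pattern is a term all of whose subterms are variables or of the form $f\,t_1\cdots t_n$, $f\in\mathcal{F}$. A rule $\ell\to r\ [\varphi]$ has $\ell,r$ of the same type, $\varphi$ a logical constraint, theory-sorted variables in $\mathrm{FV}(r)\setminus\mathrm{FV}(\ell)$, and $\ell=f\,t_1\cdots t_n$ a pattern containing a non-theory symbol; $\sigma$ respects it if $\sigma(x)$ is a value for $x\in\mathrm{FV}(\varphi)\cup(\mathrm{FV}(r)\setminus\mathrm{FV}(\ell))$ and $[\![\varphi\sigma]\!]=1$. An LCSTRS is a set $\mathcal{R}$ of rules with this data; $\to_{\mathcal{R}}$ consists of $C[\ell\sigma]\to C[r\sigma]$ (rule, respecting $\sigma$) and calculation steps $C[f\,v_1\cdots v_n]\to C[v']$ ($f$ theory symbol, $n>0$, values with $[\![f\,v_1\cdots v_n]\!]=[\![v']\!]$). $f$ is defined if it heads a left-hand side. $s\trianglerighteq t$ iff $s=t$, or $s=s_0\,s_1$ with $s_1\trianglerighteq t$, or $s=s_0\,s_1$ with $s_0\trianglerighteq t$ and $s_0\ne t$; $\triangleright$ is the strict part. Computability (relative to a system $\mathcal{R}$ and sort ordering $\succsim$). A sort ordering is a quasi-order on sorts with well-founded strict part $\succ$. For sort $A$ and $B=B_1\to\cdots\to B_n\to C$: $A\succsim_+B$ iff $A\succsim C$ and all $A\succ_-B_i$; $A\succ_-B$ iff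 $A\succ C$ and all $A\succsim_+B_i$. $\mathrm{Acc}(f)=\{i:B\succsim_+A_i\}$ for $f:A_1\to\cdots\to A_n\to B$, $B$ a sort. $s\trianglerighteq_{\mathrm{acc}}t$ iff $s=t$ or $s=f\,s_1\cdots s_m$ with $s_k\trianglerighteq_{\mathrm{acc}}t$ for some $k\in\mathrm{Acc}(f)$. $\mathcal{R}$ is AFP (witnessed by $\succsim$) if for every rule $f\,s_1\cdots s_m\to r\ [\varphi]$ and $x\in(\mathrm{FV}(f\,s_1\cdots s_m)\cap\mathrm{FV}(r))\setminus\mathrm{FV}(\varphi)$ some $s_k\trianglerighteq_{\mathrm{acc}}x$. An RC-set is a sort-indexed family $(I_A)$ of sets of terminating terms of type $A$, closed under $\to_{\mathcal{R}}$, containing each neutral term $x\,t_1\cdots t_n:A$ all of whose reducts lie in $I_A$. $t$ is $I$-computable if of sort type and in $I$, or of type $A\to B$ and $t\,u$ is $I$-computable for all $I$-computable $u:A$. $s\Rrightarrow_It$ iff both of base type, $s=f\,s_1\cdots s_m$, $t=s_k\,t_1\cdots t_n$, $k\in\mathrm{Acc}(f)$, all $t_i$ $I$-computable. $\mathbb{C}$ is the (known to exist) RC-set with $t\in\mathbb{C}_A$ iff $t:A$ terminates under $\to_{\mathcal{R}}\cup\Rrightarrow_{\mathbb{C}}$ and each reduct $t'=f\,t_1\cdots t_n$ of $t$ (w.r.t. $\to_{\mathcal{R}}^*$) has $t_i$ $\mathbb{C}$-computable for $i\in\mathrm{Acc}(f)$. Computable means $\mathbb{C}$-computable. SDPs.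 For the defined symbols $\mathcal{D}$ of $\mathcal{R}_0$, fresh sort $\mathsf{dp}$ and fresh $f^\sharp:A_1\to\cdots\to A_n\to\mathsf{dp}$ for $f:A_1\to\cdots\to A_n\to B$ ($B$ sort); $(f\,t_1\cdots t_n)^\sharp=f^\sharp\,t_1\cdots t_n$. An SDP is $s^\sharp\Rightarrow t^\sharp\ [\varphi\mid L]$ ($\mathsf{dp}$-typed sides, $\varphi$ logical constraint, $L\supseteq\mathrm{FV}(\varphi)$ theory-sorted variables). For a rule $\ell\to r\ [\varphi]$, $\mathrm{SDP}$ contains $\ell^\sharp\,x_1\cdots x_m\Rightarrow g^\sharp\,t_1\cdots t_q\,y_{q+1}\cdots y_n\ [\varphi\mid\mathrm{FV}(\varphi)\cup(\mathrm{FV}(r)\setminus\mathrm{FV}(\ell))]$ whenever $\ell^\sharp:A_1\to\cdots\to A_m\to\mathsf{dp}$, $x_i:A_i$ fresh, $r\,x_1\cdots x_m\trianglerighteq g\,t_1\cdots t_q$ with $g\in\mathcal{D}$, $g^\sharp:B_1\to\cdots\to B_n\to\mathsf{dp}$, $y_i:B_i$ fresh. $\mathrm{SDP}(\mathcal{R}_0)$ is the union over rules of $\mathcal{R}_0$. $\sigma$ respects an SDP if $\sigma(x)$ is a ground theory term for $x\in L$ and $[\![\varphi\sigma]\!]=1$. A $(\mathcal{P},\mathcal{R})$-chain is a finite or infinite sequence $(p_i,\sigma_i)$, $p_i=s_i^\sharp\Rightarrow t_i^\sharp\ [\varphi_i\mid L_i]\in\mathcal{P}$, $\sigma_i$ respecting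 $p_i$, $t_{i-1}^\sharp\sigma_{i-1}\to_{\mathcal{R}}^*s_i^\sharp\sigma_i$; computable if $u\sigma_i$ is computable whenever $t_i\triangleright u$ ($t_i$ = $t_i^\sharp$ unmarked). Extensions and public computability. An LCSTRS $\mathcal{R}_1$ is an extension of $\mathcal{R}_0$ if their interpretations agree on common theory symbols and no function symbol of $\mathcal{R}_0$ is defined by a rule of $\mathcal{R}_1$; $\mathcal{R}_0\cup\mathcal{R}_1$ is then a hierarchical combination. Given a set $H$ of hidden symbols of $\mathcal{R}_0$, an extension is public if no hidden symbol occurs in any of its rules. A term $t$ of $\mathcal{R}_0$ is publicly computable if for every public extension $\mathcal{R}_1$ and every sort ordering $\succsim'$ on the sorts of $\mathcal{R}_0\cup\mathcal{R}_1$ coinciding with $\succsim$ on sorts of $\mathcal{R}_0$, $t$ is $\mathbb{C}$-computable in $\mathcal{R}_0\cup\mathcal{R}_1$ with $\succsim'$. $\mathcal{R}_0$ is publicly computable if all its public terms (terms containing no hidden symbol) are. An SDP $f^\sharp\,s_1\cdots s_m\Rightarrow t^\sharp\ [\varphi\mid L]$ is public if $f\notin H$; a chain is public if its first SDP is public. *)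

(* Defs.v *)
(* Every system lives over one alphabet of names: base sort names [B], each with
   a carrier [X b]; function symbol names [F], each with a type [typ f].  A
   system selects its own sorts, theory sorts, function symbols and theory
   symbols from the alphabet, so that two systems may overlap and be united. *)
From Stdlib Require Import List Relations ClassicalEpsilon.
Import ListNotations.

Set Implicit Arguments.
Unset Strict Implicit.

(* [SDp] is the sort dp.  It is a constructor of its own, hence fresh: no system
   may have it among its sorts (see [is_lcstrs]). *)
Inductive sort (B : Type) : Type :=
| SBool
| SDp
| SBase (b : B).
Arguments SBool {B}.
Arguments SDp {B}.

Inductive ty (B : Type) : Type :=
| TSort (A : sort B)
| TArr (A1 A2 : ty B).

(* [Mark f] is the fresh symbol f^#. *)
Inductive sym (F : Type) : Type :=
| Fun (f : F)
| Mark (f : F).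

(* Variables carry their type; there are infinitely many of each type. *)
Record var (B : Type) : Type := MkVar { vty : ty B; vid : nat }.

(* Raw terms; well-typedness is [has_type]. *)
Inductive term (B F : Type) : Type :=
| Var (x : var B)
| Sym (a : sym F)
| App (s t : term B F).
Arguments Var {B F} x.
Arguments Sym {B F} a.

Section Syntax.
Context {B F : Type}.
Implicit Types (s t u : term B F) (x : var B).

Definition apps (t : term B F) (ts : list (term B F)) : term B F :=
  fold_left (@App B F) ts t.

Definition arrs (As : list (ty B)) (C : ty B) : ty B :=
  fold_right (@TArr B) C As.

Fixpoint targs (A : ty B) : list (ty B) :=
  match A with
  | TSort _ => []
  | TArr A1 A2 => A1 :: targs A2
  end.

Fixpoint tres (A : ty B) : sort B :=
  match A with
  | TSort C => C
  | TArr _ A2 => tres A2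
  end.

Fixpoint sorts_in (P : sort B -> Prop) (A : ty B) : Prop :=
  match A with
  | TSort C => P C
  | TArr A1 A2 => sorts_in P A1 /\ sorts_in P A2
  end.

(* T_th ::= S_th | S_th -> T_th *)
Fixpoint theory_type (Sth : sort B -> Prop) (A : ty B) : Prop :=
  match A with
  | TSort C => Sth C
  | TArr A1 A2 => (exists C, A1 = TSort C /\ Sth C) /\ theory_type Sth A2
  end.

Fixpoint fv (t : term B F) (x : var B) : Prop :=
  match t with
  | Var y => y = x
  | Sym _ => False
  | App t1 t2 => fv t1 x \/ fv t2 x
  end.

Fixpoint occ (a : sym F) (t : term B F) : Prop :=
  match t with
  | Var _ => False
  | Sym b => b = a
  | App t1 t2 => occ a t1 \/ occ a t2
  end.

Definition subst := var B -> term B F.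

Fixpoint app_subst (sigma : subst) (t : term B F) : term B F :=
  match t with
  | Var x => sigma x
  | Sym a => Sym a
  | App t1 t2 => App (app_subst sigma t1) (app_subst sigma t2)
  end.

(* The side condition of [sub_head] excludes the proper prefixes f t1 ... tk of
   f t1 ... tn. *)
Inductive subterm : term B F -> term B F -> Prop :=
| sub_refl t : subterm t t
| sub_arg s0 s1 t : subterm s1 t -> subterm (App s0 s1) t
| sub_head s0 s1 t : subterm s0 t -> s0 <> t -> subterm (App s0 s1) t.

Definition strict_subterm s t : Prop := subterm s t /\ ~ subterm t s.

Definition pattern (t : term B F) : Prop :=
  forall u, subterm t u ->
    (exists x, u = Var x) \/ (exists f us, u = apps (Sym (Fun f)) us).

(* (f t1 ... tn)^# = f^# t1 ... tn, and back. *)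
Fixpoint mark (t : term B F) : term B F :=
  match t with
  | Sym (Fun f) => Sym (Mark f)
  | App t1 t2 => App (mark t1) t2
  | _ => t
  end.

Fixpoint unmark (t : term B F) : term B F :=
  match t with
  | Sym (Mark f) => Sym (Fun f)
  | App t1 t2 => App (unmark t1) t2
  | _ => t
  end.

Definition terminating (r : term B F -> term B F -> Prop) (t : term B F) : Prop :=
  Acc (fun v u => r u v) t.

Record rule := MkRule { lhs : term B F; rhs : term B F; cstr : term B F }.

End Syntax.

Arguments subst B F : clear implicits.
Arguments rule B F : clear implicits.

Definition den_sort (B : Type) (X : B -> Type) (A : sort B) : Type :=
  match A with
  | SBool => bool
  | SDp => Empty_set
  | SBase b => X b
  end.

Fixpoint den (B : Type) (X : B -> Type) (A : ty B) : Type :=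
  match A with
  | TSort C => den_sort X C
  | TArr A1 A2 => den X A1 -> den X A2
  end.

Definition mark_ty (B : Type) (A : ty B) : ty B := arrs (targs A) (TSort SDp).

(* The theory symbols are the elements of the domain of [interp]. *)
Record lcstrs (B F : Type) (X : B -> Type) (typ : F -> ty B) := MkLcstrs {
  sorts : sort B -> Prop;
  thsorts : sort B -> Prop;
  syms : F -> Prop;
  interp : forall f : F, option (den X (typ f));
  rules : rule B F -> Prop
}.

Section Systems.
Context {B F : Type} {X : B -> Type} {typ : F -> ty B}.
Implicit Types (R : lcstrs X typ) (s t u : term B F) (x : var B).

Definition sym_ty (a : sym F) : ty B :=
  match a with
  | Fun f => typ f
  | Mark f => mark_ty (typ f)
  end.

Inductive has_type (P : sort B -> Prop) (Q : sym F -> Prop) :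
  term B F -> ty B -> Prop :=
| ht_var x : sorts_in P (vty x) -> has_type P Q (Var x) (vty x)
| ht_sym a : Q a -> has_type P Q (Sym a) (sym_ty a)
| ht_app s t A1 A2 :
    has_type P Q s (TArr A1 A2) -> has_type P Q t A1 -> has_type P Q (App s t) A2.

Definition defined R (f : F) : Prop :=
  exists p ts, rules R p /\ lhs p = apps (Sym (Fun f)) ts.

(* Terms of [R], and terms of [R] extended by f^# for the defined symbols f. *)
Definition typed R (t : term B F) (A : ty B) : Prop :=
  has_type (sorts R) (fun a => exists f, a = Fun f /\ syms R f) t A.

Definition typed_sharp R (t : term B F) (A : ty B) : Prop :=
  has_type (sorts R)
    (fun a => exists f, a = Fun f /\ syms R f \/ a = Mark f /\ defined R f) t A.

Definition thsym R (f : F) : Prop := interp R f <> None.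

Definition theory_term R (t : term B F) : Prop :=
  forall a, occ a t -> exists f, a = Fun f /\ thsym R f.

Definition ground_theory_term R (t : term B F) : Prop :=
  theory_term R t /\ forall x, ~ fv t x.

Definition value R (t : term B F) : Prop :=
  exists f A, t = Sym (Fun f) /\ thsym R f /\ typ f = TSort A.

Unset Implicit Arguments.

(* [eval R A t d]: t is a ground theory term of type A with [[t]] = d. *)
Inductive eval R : forall A : ty B, term B F -> den X A -> Prop :=
| ev_sym f (d : den X (typ f)) :
    interp R f = Some d -> eval R (typ f) (Sym (Fun f)) d
| ev_app A1 A2 t0 t1 (g : den X (TArr A1 A2)) (d : den X A1) :
    eval R (TArr A1 A2) t0 g -> eval R A1 t1 d -> eval R A2 (App t0 t1) (g d).

Set Implicit Arguments.

Definition theory_sorted R (x : var B) : Prop :=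
  exists A, vty x = TSort A /\ thsorts R A.

Definition logical_constraint R (phi : term B F) : Prop :=
  typed R phi (TSort SBool) /\ theory_term R phi /\
  forall x, fv phi x -> theory_sorted R x.

Definition is_rule R (p : rule B F) : Prop :=
  (exists A, typed R (lhs p) A /\ typed R (rhs p) A) /\
  logical_constraint R (cstr p) /\
  (forall x, fv (rhs p) x -> ~ fv (lhs p) x -> theory_sorted R x) /\
  (exists f ts, lhs p = apps (Sym (Fun f)) ts) /\
  pattern (lhs p) /\
  (exists f, occ (Fun f) (lhs p) /\ ~ thsym R f).

(* The fifth clause is bijectivity of the interpretation on the values of each
   theory sort.  As [den X (TSort SBool)] is [bool], it also provides the values
   t and f of sort bool. *)
Definition is_lcstrs R : Prop :=
  ~ sorts R SDp /\
  (thsorts R SBool /\ forall A, thsorts R A -> sorts R A) /\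
  (forall f, syms R f -> sorts_in (sorts R) (typ f)) /\
  (forall f, thsym R f -> syms R f /\ theory_type (thsorts R) (typ f)) /\
  (forall A, thsorts R A -> forall d : den X (TSort A),
     exists! f, eval R (TSort A) (Sym (Fun f)) d) /\
  (forall p, rules R p -> is_rule R p).

Definition type_preserving R (sigma : subst B F) : Prop :=
  forall x, sorts_in (sorts R) (vty x) -> typed R (sigma x) (vty x).

Definition respects_rule R (sigma : subst B F) (p : rule B F) : Prop :=
  (forall x, fv (cstr p) x \/ (fv (rhs p) x /\ ~ fv (lhs p) x) ->
     value R (sigma x)) /\
  eval R (TSort SBool) (app_subst sigma (cstr p)) true.

Inductive step R : term B F -> term B F -> Prop :=
| step_rule p sigma :
    rules R p -> type_preserving R sigma -> respects_rule R sigma p ->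
    step R (app_subst sigma (lhs p)) (app_subst sigma (rhs p))
| step_calc f vs v' A (d : den X (TSort A)) :
    thsym R f -> vs <> [] -> (forall v, In v vs -> value R v) -> value R v' ->
    eval R (TSort A) (apps (Sym (Fun f)) vs) d -> eval R (TSort A) v' d ->
    step R (apps (Sym (Fun f)) vs) v'
| step_appl s s' t : step R s s' -> step R (App s t) (App s' t)
| step_appr s t t' : step R t t' -> step R (App s t) (App s t').

Definition steps R := clos_refl_trans (term B F) (step R).

Definition strict (ge : sort B -> sort B -> Prop) (A C : sort B) : Prop :=
  ge A C /\ ~ ge C A.

Definition sort_ordering (P : sort B -> Prop) (ge : sort B -> sort B -> Prop) : Prop :=
  (forall A, P A -> ge A A) /\
  (forall A C D, P A -> P C -> P D -> ge A C -> ge C D -> ge A D) /\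
  well_founded (fun C A => P A /\ P C /\ strict ge A C).

Fixpoint ge_pos (ge : sort B -> sort B -> Prop) (A : sort B) (T : ty B) : Prop :=
  match T with
  | TSort C => ge A C
  | TArr T1 T2 => gt_neg ge A T1 /\ ge_pos ge A T2
  end
with gt_neg (ge : sort B -> sort B -> Prop) (A : sort B) (T : ty B) : Prop :=
  match T with
  | TSort C => strict ge A C
  | TArr T1 T2 => ge_pos ge A T1 /\ gt_neg ge A T2
  end.

(* Argument positions are counted from 0. *)
Definition acc_pos (ge : sort B -> sort B -> Prop) (f : F) (i : nat) : Prop :=
  exists A, nth_error (targs (typ f)) i = Some A /\ ge_pos ge (tres (typ f)) A.

Inductive subterm_acc (ge : sort B -> sort B -> Prop) :
  term B F -> term B F -> Prop :=
| suba_refl t : subterm_acc ge t t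
| suba_arg f ss k sk t :
    nth_error ss k = Some sk -> acc_pos ge f k -> subterm_acc ge sk t ->
    subterm_acc ge (apps (Sym (Fun f)) ss) t.

Definition AFP R (ge : sort B -> sort B -> Prop) : Prop :=
  forall p f ss x, rules R p -> lhs p = apps (Sym (Fun f)) ss ->
    fv (lhs p) x -> fv (rhs p) x -> ~ fv (cstr p) x ->
    exists sk, In sk ss /\ subterm_acc ge sk (Var x).

Definition RC_set R (I : sort B -> term B F -> Prop) : Prop :=
  forall A, sorts R A ->
    (forall t, I A t -> typed R t (TSort A) /\ terminating (step R) t) /\
    (forall s t, I A s -> step R s t -> I A t) /\
    (forall x ts, typed R (apps (Var x) ts) (TSort A) ->
       (forall t', step R (apps (Var x) ts) t' -> I A t') ->
       I A (apps (Var x) ts)).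

Fixpoint comp_at R (I : sort B -> term B F -> Prop) (T : ty B) (t : term B F) : Prop :=
  typed R t T /\
  match T with
  | TSort A => I A t
  | TArr T1 T2 => forall u, comp_at R I T1 u -> comp_at R I T2 (App t u)
  end.

Definition I_computable R I (t : term B F) : Prop := exists T, comp_at R I T t.

Definition arg_step R (ge : sort B -> sort B -> Prop) I (s t : term B F) : Prop :=
  (exists A, typed R s (TSort A)) /\ (exists A, typed R t (TSort A)) /\
  exists f ss k sk ts,
    s = apps (Sym (Fun f)) ss /\ nth_error ss k = Some sk /\ t = apps sk ts /\
    acc_pos ge f k /\ forall ti, In ti ts -> I_computable R I ti.

Definition C_property R (ge : sort B -> sort B -> Prop)
    (I : sort B -> term B F -> Prop) : Prop :=
  RC_set R I /\
  forall A t, sorts R A ->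
    (I A t <->
     typed R t (TSort A) /\
     terminating (fun u v => step R u v \/ arg_step R ge I u v) t /\
     forall f ts, steps R t (apps (Sym (Fun f)) ts) ->
       forall i ti, nth_error ts i = Some ti -> acc_pos ge f i ->
         I_computable R I ti).

(* [C_property] need not determine the family, so C is some fixed family having
   it, picked by Hilbert's epsilon. *)
Definition C R (ge : sort B -> sort B -> Prop) : sort B -> term B F -> Prop :=
  epsilon (inhabits (fun _ _ => False)) (C_property R ge).

Definition computable R (ge : sort B -> sort B -> Prop) (t : term B F) : Prop :=
  I_computable R (C R ge) t.

Record sdp := MkSdp {
  sdp_lhs : term B F;
  sdp_rhs : term B F;
  sdp_cstr : term B F;
  sdp_L : var B -> Prop
}.

(* All choices of fresh variables are included. *)
Inductive SDP R : sdp -> Prop :=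
| SDP_intro p As xs g ts ys :
    rules R p ->
    typed_sharp R (mark (lhs p)) (arrs As (TSort SDp)) ->
    map (@vty B) xs = As ->
    defined R g ->
    subterm (apps (rhs p) (map Var xs)) (apps (Sym (Fun g)) ts) ->
    length ts <= length (targs (typ g)) ->
    map (@vty B) ys = skipn (length ts) (targs (typ g)) ->
    NoDup (xs ++ ys) ->
    (forall x, In x (xs ++ ys) ->
       ~ fv (lhs p) x /\ ~ fv (rhs p) x /\ ~ fv (cstr p) x) ->
    SDP R {| sdp_lhs := apps (mark (lhs p)) (map Var xs);
             sdp_rhs := apps (Sym (Mark g)) (ts ++ map Var ys);
             sdp_cstr := cstr p;
             sdp_L := fun x =>
               fv (cstr p) x \/ (fv (rhs p) x /\ ~ fv (lhs p) x) |}.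

Definition respects_sdp R (sigma : subst B F) (p : sdp) : Prop :=
  (forall x, sdp_L p x -> ground_theory_term R (sigma x)) /\
  eval R (TSort SBool) (app_subst sigma (sdp_cstr p)) true.

Definition infinite_chain (P : sdp -> Prop) R
    (p : nat -> sdp) (sigma : nat -> subst B F) : Prop :=
  forall i,
    P (p i) /\ type_preserving R (sigma i) /\ respects_sdp R (sigma i) (p i) /\
    steps R (app_subst (sigma i) (sdp_rhs (p i)))
            (app_subst (sigma (S i)) (sdp_lhs (p (S i)))).

Definition computable_chain R (ge : sort B -> sort B -> Prop)
    (p : nat -> sdp) (sigma : nat -> subst B F) : Prop :=
  forall i u, strict_subterm (unmark (sdp_rhs (p i))) u ->
    computable R ge (app_subst (sigma i) u).

Definition public_sdp (H : F -> Prop) (p : sdp) : Prop :=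
  exists f ss, sdp_lhs p = apps (Sym (Mark f)) ss /\ ~ H f.

Definition union R0 R1 : lcstrs X typ := {|
  sorts := fun A => sorts R0 A \/ sorts R1 A;
  thsorts := fun A => thsorts R0 A \/ thsorts R1 A;
  syms := fun f => syms R0 f \/ syms R1 f;
  interp := fun f =>
    match interp R0 f with
    | Some d => Some d
    | None => interp R1 f
    end;
  rules := fun p => rules R0 p \/ rules R1 p
|}.

(* The second clause makes explicit that R0 and R1 are compatible enough for
   their union to be a system again; this does not follow from the other
   clauses, e.g. when R0 and R1 name the same element of a common theory sort
   by different values. *)
Definition extension R0 R1 : Prop :=
  is_lcstrs R1 /\
  is_lcstrs (union R0 R1) /\
  (forall f d0 d1, interp R0 f = Some d0 -> interp R1 f = Some d1 -> d0 = d1) /\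
  (forall f, syms R0 f -> ~ defined R1 f).

Definition public_term (H : F -> Prop) (t : term B F) : Prop :=
  forall f, H f -> ~ occ (Fun f) t.

Definition public_extension R0 (H : F -> Prop) R1 : Prop :=
  extension R0 R1 /\
  forall p, rules R1 p ->
    public_term H (lhs p) /\ public_term H (rhs p) /\ public_term H (cstr p).

Definition extends_ordering R0 R1 (ge ge' : sort B -> sort B -> Prop) : Prop :=
  sort_ordering (sorts (union R0 R1)) ge' /\
  forall A C, sorts R0 A -> sorts R0 C -> (ge' A C <-> ge A C).

Definition publicly_computable_term R0 ge (H : F -> Prop) (t : term B F) : Prop :=
  forall R1 ge', public_extension R0 H R1 -> extends_ordering R0 R1 ge ge' ->
    computable (union R0 R1) ge' t.

Definition publicly_computable R0 ge (H : F -> Prop) : Prop :=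
  forall t T, typed R0 t T -> public_term H t ->
    publicly_computable_term R0 ge H t.

End Systems.

(* Main.v *)
(** The reducibility family C exists by well-founded recursion on sorts: on one
    equivalence class of sorts, with C fixed on the smaller sorts, its defining
    condition is monotone, so the least solution is a fixpoint.

    In the union of R0 with an extension, a symbol g of R0 that is not computable
    has computable arguments vs such that g vs is outside C.  Reductions of the
    arguments and calculation steps stay inside C, so some rule of R0 applied at
    the head leads to an instance of its right-hand side outside C.  By AFP the
    substitution is computable on the variables of the right-hand side; hence a
    minimal non-computable subterm is headed by a defined symbol of R0 with
    computable arguments.  This is one link of a computable chain and restores
    the initial situation, so a non-computable public symbol starts an infinite
    public chain. *)
From Stdlib Require Import List Relations Arith Lia Classical ClassicalEpsilon
  FunctionalExtensionality PropExtensionality.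
Require Import Defs.
Import ListNotations.

Set Implicit Arguments.
Unset Strict Implicit.

(** * Spines, subterms, simultaneous substitution updates and fresh variables *)

Section Spines.
Context {B F : Type}.
Implicit Types (s t u : term B F) (ts us : list (term B F)) (sigma : subst B F).

Fixpoint hd_of (t : term B F) : term B F :=
  match t with App s _ => hd_of s | _ => t end.

Fixpoint args_of (t : term B F) : list (term B F) :=
  match t with App s u => args_of s ++ [u] | _ => [] end.

Lemma apps_cat t us vs : apps t (us ++ vs) = apps (apps t us) vs.
Proof. apply fold_left_app. Qed.

Lemma apps_spine t : apps (hd_of t) (args_of t) = t.
Proof.
  induction t; simpl; auto.
  rewrite apps_cat, IHt1. reflexivity.
Qed.

Lemma hd_of_apps t us : hd_of (apps t us) = hd_of t.
Proof. revert t; induction us; intros; simpl; auto. now rewrite IHus. Qed.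

Lemma args_of_apps t us : args_of (apps t us) = args_of t ++ us.
Proof.
  revert t; induction us as [|u us IH]; intros; simpl.
  - now rewrite app_nil_r.
  - rewrite IH. simpl. now rewrite <- app_assoc.
Qed.

Lemma apps_Sym_inj a b us vs :
  apps (B := B) (F := F) (Sym a) us = apps (Sym b) vs -> a = b /\ us = vs.
Proof.
  intros E. split.
  - apply (f_equal hd_of) in E. rewrite !hd_of_apps in E. now injection E.
  - apply (f_equal args_of) in E. now rewrite !args_of_apps in E.
Qed.

Lemma hd_of_atom t : (exists x, hd_of t = Var x) \/ (exists a, hd_of t = Sym a).
Proof. induction t; simpl; eauto. Qed.

Lemma app_subst_apps sigma t us :
  app_subst sigma (apps t us) = apps (app_subst sigma t) (map (app_subst sigma) us).
Proof. revert t; induction us; intros; simpl; auto. Qed.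

Lemma map_app_subst_Var sigma xs : map (app_subst sigma) (map Var xs) = map sigma xs.
Proof. apply map_map. Qed.

Lemma mark_apps f us :
  mark (apps (B := B) (Sym (Fun f)) us) = apps (Sym (Mark f)) us.
Proof.
  induction us using rev_ind; auto. rewrite !apps_cat. simpl. now rewrite IHus.
Qed.

Lemma unmark_apps f us :
  unmark (apps (B := B) (Sym (Mark f)) us) = apps (Sym (Fun f)) us.
Proof.
  induction us using rev_ind; auto. rewrite !apps_cat. simpl. now rewrite IHus.
Qed.

Lemma fv_apps t us x : fv (apps t us) x <-> fv t x \/ exists u, In u us /\ fv u x.
Proof.
  revert t; induction us as [|u us IH]; intros t; simpl.
  - firstorder.
  - rewrite IH. simpl. split.
    + intros [[?|?]|(v & ? & ?)]; eauto.
    + intros [?|(v & [<-|?] & ?)]; eauto.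
Qed.

Lemma app_subst_ext sigma tau t :
  (forall x, fv t x -> sigma x = tau x) -> app_subst sigma t = app_subst tau t.
Proof.
  induction t; simpl; intros E; auto.
  rewrite IHt1, IHt2; auto.
Qed.

Lemma fv_vid_bound t : exists N, forall x, fv t x -> vid x < N.
Proof.
  induction t as [x|a|s [N HN] t [M HM]]; simpl.
  - exists (S (vid x)). intros y <-. lia.
  - exists 0. tauto.
  - exists (N + M). intros x [h|h]; [apply HN in h|apply HM in h]; lia.
Qed.

Fixpoint tsize (t : term B F) : nat :=
  match t with App s u => S (tsize s + tsize u) | _ => 1 end.

Lemma subterm_tsize s t : subterm s t -> s = t \/ tsize t < tsize s.
Proof.
  induction 1; simpl; auto; right.
  - destruct IHsubterm as [->|?]; lia.
  - destruct IHsubterm as [->|?]; lia.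
Qed.

(** The side condition of [sub_head] survives composition by comparing sizes: [s0 = u] would make
    [s0] and [t] subterms of each other, hence equal. *)
Lemma subterm_trans s t u : subterm s t -> subterm t u -> subterm s u.
Proof.
  intros Hst; revert u. induction Hst as [|s0 s1 t h IH|s0 s1 t h IH ne]; intros u Htu; auto.
  - apply sub_arg; auto.
  - apply sub_head; auto. intros ->.
    destruct (subterm_tsize h), (subterm_tsize Htu); subst; auto; lia.
Qed.

(** Since proper prefixes of the spine do not count as subterms, control over the arguments gives
    control over every strict subterm. *)
Lemma subterm_args t u : subterm t u -> u = t \/ exists v, In v (args_of t) /\ subterm v u.
Proof.
  induction 1 as [|s0 s1 t h IH|s0 s1 t h IH ne]; simpl; auto; right.
  - exists s1. split; auto. apply in_or_app; simpl; auto.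
  - destruct IH as [->|(v & ? & ?)]; [congruence|].
    exists v. split; auto. apply in_or_app; auto.
Qed.

Lemma args_of_tsize t u : In u (args_of t) -> tsize u < tsize t.
Proof.
  induction t; simpl; try tauto. intros h; apply in_app_or in h.
  destruct h as [h|[<-|[]]]; [apply IHt1 in h|]; lia.
Qed.

Lemma args_of_subterm t u : In u (args_of t) -> subterm t u.
Proof.
  induction t; simpl; try tauto. intros h; apply in_app_or in h.
  destruct h as [h|[<-|[]]].
  - apply sub_head; auto. intros ->. apply args_of_tsize in h. lia.
  - apply sub_arg, sub_refl.
Qed.

Lemma fv_subterm t u x : subterm t u -> fv u x -> fv t x.
Proof. induction 1; simpl; auto. Qed.

(** Equality of variables is decided classically, because nothing is assumed about equality of sort
    names. *)
Definition upd sigma (x : var B) u : subst B F :=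
  fun y => if excluded_middle_informative (x = y) then u else sigma y.

Fixpoint upds sigma (xs : list (var B)) us : subst B F :=
  match xs, us with
  | x :: xs, u :: us => upd (upds sigma xs us) x u
  | _, _ => sigma
  end.

Lemma upds_notin sigma xs us y : ~ In y xs -> upds sigma xs us y = sigma y.
Proof.
  revert us; induction xs as [|x xs IH]; intros [|u us]; simpl; auto. intros n.
  unfold upd. destruct excluded_middle_informative; [tauto|]. apply IH; tauto.
Qed.

Lemma map_upds sigma xs us :
  NoDup xs -> length xs = length us -> map (upds sigma xs us) xs = us.
Proof.
  revert us; induction xs as [|x xs IH]; intros [|u us] nd E; simpl in *; try easy.
  inversion nd; subst. f_equal.
  - unfold upd. destruct excluded_middle_informative; tauto.
  - rewrite <- (IH us) at 2 by auto. apply map_ext_in. intros y hy.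
    unfold upd. destruct excluded_middle_informative as [->|]; tauto.
Qed.

(** Consecutive indices keep the variables distinct even when types repeat, and any bound on the
    indices in a term makes them fresh for it. *)
Fixpoint fresh_vars (N : nat) (As : list (ty B)) : list (var B) :=
  match As with [] => [] | A :: As => MkVar A N :: fresh_vars (S N) As end.

Lemma vty_fresh_vars N As : map (@vty B) (fresh_vars N As) = As.
Proof. revert N; induction As; intros; simpl; f_equal; auto. Qed.

Lemma length_fresh_vars N As : length (fresh_vars N As) = length As.
Proof. rewrite <- (vty_fresh_vars N As) at 2. now rewrite length_map. Qed.

Lemma in_fresh_vars N As x : In x (fresh_vars N As) -> N <= vid x < N + length As.
Proof.
  revert N; induction As; intros N; simpl; [tauto|].
  intros [<-|h]; simpl; [lia|]. apply IHAs in h. lia.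
Qed.

Lemma NoDup_fresh_vars N As : NoDup (fresh_vars N As).
Proof.
  revert N; induction As; intros N; simpl; constructor; auto.
  intros h%in_fresh_vars. simpl in h. lia.
Qed.

Lemma fresh_vars_cat N As Cs :
  fresh_vars N (As ++ Cs) = fresh_vars N As ++ fresh_vars (N + length As) Cs.
Proof.
  revert N; induction As; intros N; simpl.
  - now rewrite Nat.add_0_r.
  - rewrite IHAs. now replace (S N + length As) with (N + S (length As)) by lia.
Qed.

End Spines.

(** * Argument and result sorts of types, and typing of spines *)

Section Types.
Context {B : Type}.
Implicit Types T : ty B.

Lemma targs_arrs As T : targs (arrs As T) = As ++ targs T.
Proof. induction As; simpl; f_equal; auto. Qed.

Lemma tres_arrs As T : tres (arrs As T) = tres T.
Proof. induction As; simpl; auto. Qed.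

Lemma arrs_targs T : arrs (targs T) (TSort (tres T)) = T.
Proof. induction T; simpl; f_equal; auto. Qed.

Lemma mark_ty_arrs As T : mark_ty (arrs As T) = arrs As (mark_ty T).
Proof. unfold mark_ty. rewrite targs_arrs. apply fold_right_app. Qed.

Lemma sorts_in_arrs (P : sort B -> Prop) As T :
  sorts_in P (arrs As T) <-> Forall (sorts_in P) As /\ sorts_in P T.
Proof.
  induction As; simpl.
  - intuition.
  - rewrite IHAs, Forall_cons_iff. tauto.
Qed.

Lemma sorts_in_mono (P Q : sort B -> Prop) T :
  (forall A, P A -> Q A) -> sorts_in P T -> sorts_in Q T.
Proof. intros h; induction T; simpl; firstorder. Qed.

End Types.

Section Typing.
Context {B F : Type} {typ : F -> ty B}.
Variables (P : sort B -> Prop) (Q : sym F -> Prop).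
Notation has_type := (has_type (typ := typ) P Q).

Lemma has_type_unique t A A' : has_type t A -> has_type t A' -> A = A'.
Proof.
  intros h; revert A'. induction h; intros A' h'; inversion h'; subst; auto.
  match goal with h : has_type s _ |- _ => apply IHh1 in h; congruence end.
Qed.

Lemma has_type_apps_inv h ts T :
  has_type (apps h ts) T ->
  exists Ts, has_type h (arrs Ts T) /\ Forall2 has_type ts Ts.
Proof.
  revert h; induction ts as [|t ts IH]; simpl; intros h ht.
  - exists []. auto.
  - apply IH in ht as (Ts & h1 & h2). inversion h1; subst.
    match goal with a : has_type t ?A |- _ => exists (A :: Ts) end. simpl; auto.
Qed.

Lemma has_type_apps h ts Ts T :
  has_type h (arrs Ts T) -> Forall2 has_type ts Ts -> has_type (apps h ts) T.
Proof.
  intros h1 h2; revert h h1. induction h2; simpl; intros; auto.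
  apply IHh2. econstructor; eauto.
Qed.

Lemma has_type_subterm t u T : subterm t u -> has_type t T -> exists U, has_type u U.
Proof.
  intros h; revert T. induction h; intros T ht; eauto; inversion ht; subst; eauto.
Qed.

End Typing.

Lemma has_type_mono {B F : Type} {typ : F -> ty B} (P P' : sort B -> Prop)
    (Q Q' : sym F -> Prop) t T :
  (forall A, P A -> P' A) -> (forall a, Q a -> Q' a) ->
  has_type (typ := typ) P Q t T -> has_type (typ := typ) P' Q' t T.
Proof.
  intros hP hQ; induction 1; econstructor; eauto using sorts_in_mono.
Qed.

Lemma Forall2_nth {S T : Type} (R : S -> T -> Prop) ss ts i s :
  Forall2 R ss ts -> nth_error ss i = Some s -> exists t, nth_error ts i = Some t /\ R s t.
Proof.
  intros h; revert i; induction h; intros [|i]; simpl; try discriminate; eauto.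
  intros [= ->]; eauto.
Qed.

Lemma Forall2_In_l {S T : Type} (R : S -> T -> Prop) ss ts s :
  Forall2 R ss ts -> In s ss -> exists t, In t ts /\ R s t.
Proof.
  induction 1; simpl; [tauto|]. intros [<-|h]; eauto. destruct IHForall2 as (?&?&?); eauto.
Qed.

(** * Reduction: preservation of types, root steps and steps inside arguments *)

Section Reduction.
Context {B F : Type} {X : B -> Type} {typ : F -> ty B} (R : lcstrs X typ).
Hypothesis R_lcstrs : is_lcstrs R.
Implicit Types (s t u : term B F) (sigma : subst B F).

Lemma typed_sorts t T : typed R t T -> sorts_in (sorts R) T.
Proof.
  destruct R_lcstrs as (_ & _ & hs & _).
  induction 1 as [x|a (f & -> & hf)|s t A1 A2 _ IH]; simpl in *; auto. tauto.
Qed.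

Lemma typed_Sym_inv f T : typed R (Sym (Fun f)) T -> T = typ f /\ syms R f.
Proof. intros h; inversion h as [|a (g & [= ->] & hg)|]; subst; auto. Qed.

Lemma typed_Sym f : syms R f -> typed R (Sym (Fun f)) (typ f).
Proof. intros h. apply (@ht_sym _ _ typ _ _ (Fun f)). eauto. Qed.

Lemma typed_unique t T T' : typed R t T -> typed R t T' -> T = T'.
Proof. apply has_type_unique. Qed.

Lemma typed_apps_Sym_inv f ts T :
  typed R (apps (Sym (Fun f)) ts) T ->
  exists Ts, typ f = arrs Ts T /\ syms R f /\ Forall2 (typed R) ts Ts.
Proof.
  intros (Ts & h1 & h2)%has_type_apps_inv.
  apply typed_Sym_inv in h1 as [<- h1]. eauto.
Qed.

Lemma eval_typed A t d : eval R A t d -> typed R t A.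
Proof.
  destruct R_lcstrs as (_ & _ & _ & hth & _).
  induction 1 as [f d E|]; [|econstructor; eauto].
  apply typed_Sym, hth. unfold thsym. congruence.
Qed.

Lemma typed_subst sigma t T :
  type_preserving R sigma -> typed R t T -> typed R (app_subst sigma t) T.
Proof. intros hs; induction 1; simpl; [apply hs; auto|constructor; auto|econstructor; eauto]. Qed.

(** The two base cases of [step] without its closure under contexts, so that a step can be analysed
    by its position. *)
Inductive root_step : term B F -> term B F -> Prop :=
| root_rule p sigma :
    rules R p -> type_preserving R sigma -> respects_rule R sigma p ->
    root_step (app_subst sigma (lhs p)) (app_subst sigma (rhs p))
| root_calc f vs v' A (d : den X (TSort A)) :
    thsym R f -> vs <> [] -> (forall v, In v vs -> value R v) -> value R v' ->
    eval R (TSort A) (apps (Sym (Fun f)) vs) d -> eval R (TSort A) v' d ->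
    root_step (apps (Sym (Fun f)) vs) v'.

Lemma step_inv s t : step R s t ->
  root_step s t \/ exists s0 s1, s = App s0 s1 /\
    ((exists s0', step R s0 s0' /\ t = App s0' s1) \/
     (exists s1', step R s1 s1' /\ t = App s0 s1')).
Proof.
  destruct 1 as [p sigma h1 h2 h3|f vs v' A d h1 h2 h3 h4 h5 h6|s s' t h|s t t' h].
  - left; constructor; auto.
  - left; econstructor; eauto.
  - right; eauto 10.
  - right; eauto 10.
Qed.

Lemma rule_lhs_head p : rules R p -> exists f ts, lhs p = apps (Sym (Fun f)) ts.
Proof.
  intros h. destruct R_lcstrs as (_ & _ & _ & _ & _ & hr). now destruct (hr _ h) as (_ & _ & _ & h' & _).
Qed.

Lemma root_step_head s t : root_step s t -> exists f, hd_of s = Sym (Fun f).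
Proof.
  destruct 1 as [p sigma h1 h2 h3|f vs].
  - destruct (rule_lhs_head h1) as (f & ts & ->).
    exists f. now rewrite app_subst_apps, hd_of_apps.
  - exists f. now rewrite hd_of_apps.
Qed.

Lemma root_step_typed s t T : typed R s T -> root_step s t -> typed R t T.
Proof.
  intros hs h. destruct h as [p sigma h1 h2 h3|f vs v' A d h1 h2 h3 h4 h5 h6].
  - destruct R_lcstrs as (_ & _ & _ & _ & _ & hr).
    destruct (hr _ h1) as ((A & hl & hr') & _).
    rewrite (typed_unique hs (typed_subst h2 hl)). now apply typed_subst.
  - rewrite (typed_unique hs (eval_typed h5)). eapply eval_typed; eauto.
Qed.

Lemma step_typed s t T : typed R s T -> step R s t -> typed R t T.
Proof.
  intros hs h; revert T hs; induction h; intros T hs.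
  - eapply root_step_typed; eauto. now constructor.
  - eapply root_step_typed; eauto. econstructor; eauto.
  - inversion hs; subst. econstructor; eauto. now apply IHh.
  - inversion hs; subst. econstructor; eauto. now apply IHh.
Qed.

Lemma steps_typed s t T : typed R s T -> steps R s t -> typed R t T.
Proof. intros hs h; induction h; eauto using step_typed. Qed.

Lemma steps_inv s t : steps R s t -> s = t \/ exists s', step R s s' /\ steps R s' t.
Proof.
  intros h%clos_rt_rt1n. destruct h as [|s' t h1 h2]; auto.
  right; exists s'. split; auto. now apply clos_rt1n_rt.
Qed.

Inductive args_step : list (term B F) -> list (term B F) -> Prop :=
| args_step_head t t' ts : step R t t' -> args_step (t :: ts) (t' :: ts)
| args_step_tail t ts ts' : args_step ts ts' -> args_step (t :: ts) (t :: ts').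

Lemma args_step_last ts t t' : step R t t' -> args_step (ts ++ [t]) (ts ++ [t']).
Proof. induction ts; simpl; constructor; auto. Qed.

Lemma args_step_app ts ts' us : args_step ts ts' -> args_step (ts ++ us) (ts' ++ us).
Proof. induction 1; simpl; constructor; auto. Qed.

Lemma step_apps_head h h' ts : step R h h' -> step R (apps h ts) (apps h' ts).
Proof. revert h h'; induction ts; simpl; auto. intros. apply IHts. now constructor. Qed.

Lemma step_apps_args h ts ts' : args_step ts ts' -> step R (apps h ts) (apps h ts').
Proof.
  intros hs; revert h. induction hs; intros h; simpl; auto.
  apply step_apps_head. now constructor.
Qed.

(** Rules may have a functional type, so a redex at the head can cover only a prefix [us] of the
    arguments; the rest [vs] is carried along. *)
Lemma step_apps_Sym a ts t : step R (apps (Sym a) ts) t ->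
  (exists ts', args_step ts ts' /\ t = apps (Sym a) ts') \/
  (exists us vs t0, ts = us ++ vs /\ root_step (apps (Sym a) us) t0 /\ t = apps t0 vs).
Proof.
  revert t; induction ts as [|u ts IH] using rev_ind; intros t h.
  - right. exists [], [], t. split; auto. split; auto.
    destruct (step_inv h) as [?|(s0 & s1 & E & _)]; [auto|discriminate].
  - destruct (step_inv h) as [h'|(s0 & s1 & E & h')].
    + right. exists (ts ++ [u]), [], t. now rewrite app_nil_r.
    + rewrite apps_cat in E. injection E as <- <-.
      destruct h' as [(s0' & h1 & ->)|(s1' & h1 & ->)].
      * apply IH in h1 as [(ts' & h1 & ->)|(us & vs & t0 & -> & h1 & ->)].
        -- left. exists (ts' ++ [u]). rewrite apps_cat. split; auto.
           now apply args_step_app.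
        -- right. exists us, (vs ++ [u]), t0. now rewrite app_assoc, apps_cat.
      * left. exists (ts ++ [s1']). rewrite apps_cat. split; auto. now apply args_step_last.
Qed.

(** Nested induction: on termination of the first argument, then on accessibility of the remaining
    list. *)
Lemma args_step_Acc ts :
  Forall (terminating (step R)) ts -> Acc (fun us vs => args_step vs us) ts.
Proof.
  induction 1 as [|t ts ht _ IH].
  - constructor. intros us h; inversion h.
  - revert ts IH. induction ht as [t _ IHt]. intros ts hts.
    induction hts as [ts hts IHts]. constructor. intros us h; inversion h; subst.
    + apply IHt; auto. now constructor.
    + now apply IHts.
Qed.

(** A left-hand side matching a value would be a lone theory symbol, whereas left-hand sides contain
    a non-theory symbol; calculation steps need at least one argument. *)
Lemma value_root v : value R v -> forall t, ~ step R v t.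
Proof.
  intros (f & A & -> & hf & E) t h.
  destruct (step_inv h) as [h'|(s0 & s1 & E' & _)]; [|discriminate].
  inversion h' as [p sigma h1 h2 h3 E1 E2|g vs v' A' d h1 h2 h3 h4 h5 h6 E1 E2].
  - destruct (rule_lhs_head h1) as (g & ts & El).
    rewrite El, app_subst_apps in E1. apply (apps_Sym_inj (vs := [])) in E1 as [[= ->] E1].
    apply map_eq_nil in E1 as ->.
    destruct R_lcstrs as (_ & _ & _ & _ & _ & hr).
    destruct (hr _ h1) as (_ & _ & _ & _ & _ & g & hg & ng).
    rewrite El in hg. simpl in hg. injection hg as ->. auto.
  - apply (apps_Sym_inj (vs := [])) in E1 as [_ ?]. auto.
Qed.

End Reduction.

(** * The computability predicate: monotonicity, existence and closure properties *)

Section Computability.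
Context {B F : Type} {X : B -> Type} {typ : F -> ty B} (R : lcstrs X typ).
Hypothesis R_lcstrs : is_lcstrs R.
Variable ge : sort B -> sort B -> Prop.
Hypothesis ge_ordering : sort_ordering (sorts R) ge.
Implicit Types (s t u : term B F) (A : sort B) (I K : sort B -> term B F -> Prop).

Notation acc_pos := (acc_pos (typ := typ)).

(** The defining condition of the family C, isolated as an operator on [I] of which C has to be a
    fixpoint. *)
Definition C_condition I A t : Prop :=
  typed R t (TSort A) /\
  terminating (fun u v => step R u v \/ arg_step R ge I u v) t /\
  forall f ts, steps R t (apps (Sym (Fun f)) ts) ->
    forall i ti, nth_error ts i = Some ti -> acc_pos ge f i -> I_computable R I ti.

Lemma comp_at_typed I T t : comp_at R I T t -> typed R t T.
Proof. destruct T; simpl; tauto. Qed.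

Lemma computable_at I T t : I_computable R I t -> typed R t T -> comp_at R I T t.
Proof.
  intros [T' h] ht. now rewrite (typed_unique ht (comp_at_typed h)).
Qed.

Lemma ge_pos_mono A D T :
  sorts R A -> sorts R D -> ge A D -> sorts_in (sorts R) T ->
  (ge_pos ge D T -> ge_pos ge A T) /\ (gt_neg ge D T -> gt_neg ge A T).
Proof.
  intros hA hD hAD. destruct ge_ordering as (_ & tr & _).
  induction T as [E|T1 IH1 T2 IH2]; simpl.
  - intros hE. unfold strict. split; [eauto|]. intros [h1 h2]. split; [eauto|].
    intros h3. apply h2. eauto.
  - intros [h1 h2]. destruct (IH1 h1), (IH2 h2). intuition.
Qed.

Lemma ge_pos_arrs A Ts C :
  ge_pos ge A (arrs Ts (TSort C)) -> Forall (gt_neg ge A) Ts /\ ge A C.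
Proof. induction Ts; simpl; intuition. Qed.

Lemma acc_arg_typed f ss D k sk :
  typed R (apps (Sym (Fun f)) ss) (TSort D) -> nth_error ss k = Some sk ->
  acc_pos ge f k -> exists T, typed R sk T /\ ge_pos ge D T.
Proof.
  intros (Ts & E & _ & h)%typed_apps_Sym_inv hk (T & hT & hp).
  rewrite E, targs_arrs, app_nil_r in hT. rewrite E, tres_arrs in hp.
  destruct (Forall2_nth h hk) as (T' & hT' & ?). exists T. split; auto. congruence.
Qed.

(* On sorts equivalent to A, [C_condition I A] is monotone in [I]: accessible
   arguments have types in which these sorts occur only positively, and the
   arguments supplied in an [arg_step] have types in which they occur only
   negatively, so that [arg_step] shrinks as [I] grows. *)
Section Variance.
Variables (I I' : sort B -> term B F -> Prop) (A : sort B).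
Hypothesis A_sort : sorts R A.
Hypothesis below : forall C t, sorts R C -> strict ge A C -> (I C t <-> I' C t).
Hypothesis level : forall C t, sorts R C -> ge A C -> ge C A -> I C t -> I' C t.

Lemma comp_at_variance T : sorts_in (sorts R) T ->
  (ge_pos ge A T -> forall t, comp_at R I T t -> comp_at R I' T t) /\
  (gt_neg ge A T -> forall t, comp_at R I' T t -> comp_at R I T t).
Proof.
  induction T as [D|T1 IH1 T2 IH2]; simpl.
  - intros hD. split; intros h t [ht hI]; split; auto.
    + destruct (classic (ge D A)); [now apply level|]. apply below; auto. now split.
    + now apply below.
  - intros [h1 h2]. destruct (IH1 h1) as [p1 n1], (IH2 h2) as [p2 n2].
    split; intros [h3 h4] t [ht hI]; split; auto.
Qed.

Lemma computable_variance D T t :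
  sorts R D -> ge A D -> typed R t T -> ge_pos ge D T ->
  I_computable R I t -> I_computable R I' t.
Proof.
  intros hD hAD ht hp hI. exists T.
  assert (hT := typed_sorts R_lcstrs ht).
  apply comp_at_variance; auto using computable_at.
  now apply (ge_pos_mono A_sort hD hAD hT).
Qed.

Lemma arg_step_variance D s t :
  sorts R D -> ge A D -> typed R s (TSort D) -> arg_step R ge I' s t ->
  arg_step R ge I s t /\ exists D', sorts R D' /\ ge A D' /\ typed R t (TSort D').
Proof.
  intros hD hAD hs (h1 & [D' h2] & f & ss & k & sk & ts & -> & hk & -> & ha & hts).
  destruct (acc_arg_typed hs hk ha) as (T & hT & hp).
  destruct (has_type_apps_inv h2) as (Ts & hsk & hTs).
  rewrite (typed_unique hT hsk) in *.
  assert (hS := typed_sorts R_lcstrs hsk).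
  apply (ge_pos_mono A_sort hD hAD hS) in hp.
  apply ge_pos_arrs in hp as [hp hD'].
  apply sorts_in_arrs in hS as [hS1 hS2]. simpl in hS2.
  split; [|eauto].
  split; [auto|split; [eauto|]]. exists f, ss, k, sk, ts. repeat split; auto.
  intros ti hi. destruct (Forall2_In_l hTs hi) as (Ti & hTi & hti).
  rewrite Forall_forall in hp, hS1. exists Ti.
  apply comp_at_variance; auto using computable_at.
Qed.

Lemma C_condition_variance D t :
  sorts R D -> ge A D -> C_condition I D t -> C_condition I' D t.
Proof.
  intros hD hAD (ht & sn & h3). split; [auto|split].
  (* The sort [D] is generalised because an [arg_step] may change it; the new sort still lies below
     [A]. *)
  - clear h3. revert D hD hAD ht. induction sn as [t _ IH]. intros D hD hAD ht.
    constructor. intros u [hu|hu].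
    + apply (IH u (or_introl hu) D); auto. eapply step_typed; eauto.
    + destruct (arg_step_variance hD hAD ht hu) as (hu' & D' & h1 & h2 & h3).
      apply (IH u (or_intror hu') D'); auto.
  - intros f ts hs i ti hi ha.
    assert (hf := steps_typed R_lcstrs ht hs).
    destruct (acc_arg_typed hf hi ha) as (T & hT & hp).
    eapply computable_variance; eauto.
Qed.

End Variance.

(** * Construction of the family by well-founded recursion and least fixpoints *)

Definition sort_lt C A : Prop := sorts R A /\ sorts R C /\ strict ge A C.
Definition sort_eqv A C : Prop := sorts R A /\ sorts R C /\ ge A C /\ ge C A.

(** The family [I] already built on the smaller sorts, joined with a candidate [K] on the current
    equivalence class. *)
Definition glue (lt eqv : sort B -> Prop) I K : sort B -> term B F -> Prop :=
  fun C t => lt C /\ I C t \/ eqv C /\ K C t.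

(** The Knaster-Tarski least fixpoint, as the intersection of all [K] closed under the operator. It
    treats all sorts of one equivalence class at once. *)
Definition least_level (lt eqv : sort B -> Prop) I : sort B -> term B F -> Prop :=
  fun C t => forall K,
    (forall C' t', eqv C' -> C_condition (glue lt eqv I K) C' t' -> K C' t') -> K C t.

(** The recursive call [rec] is available only with a proof of [sort_lt C A]; the existential turns
    it into a family on all sorts. *)
Definition C_family : sort B -> term B F -> Prop :=
  Fix (proj2 (proj2 ge_ordering)) (fun _ => term B F -> Prop)
    (fun A rec => least_level (fun C => sort_lt C A) (sort_eqv A)
       (fun C t => exists h : sort_lt C A, rec C h t) A).

(** The existential over [sort_lt C A] disappears because [glue] consults its first family only on
    smaller sorts. *)
Lemma C_family_unfold A :
  C_family A = least_level (fun C => sort_lt C A) (sort_eqv A) C_family A.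
Proof.
  unfold C_family at 1. rewrite Fix_eq.
  - fold C_family. unfold least_level. extensionality t. apply propositional_extensionality.
    assert (E : forall K, glue (fun C => sort_lt C A) (sort_eqv A)
        (fun C t => exists _ : sort_lt C A, C_family C t) K =
      glue (fun C => sort_lt C A) (sort_eqv A) C_family K).
    { intros K. extensionality D; extensionality u.
      apply propositional_extensionality. unfold glue.
      split; intros [[h1 h2]|h]; auto; left.
      - now destruct h2.
      - split; auto. now exists h1. }
    split; intros h K hK; apply h; intros C' t'; specialize (hK C' t');
      rewrite E in *; auto.
  - intros D f g E. f_equal. extensionality C; extensionality u.
    apply propositional_extensionality. split; intros [h1 h2]; exists h1; congruence.
Qed.

(** Equivalent sorts have the same smaller sorts and the same class, so the recursion performs the
    same construction for both. *)
Lemma C_family_level A C : sort_eqv A C ->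
  C_family C = least_level (fun C => sort_lt C A) (sort_eqv A) C_family C.
Proof.
  intros (hA & hC & h1 & h2). rewrite C_family_unfold.
  destruct ge_ordering as (_ & tr & _).
  replace (fun D => sort_lt D C) with (fun D => sort_lt D A).
  replace (sort_eqv C) with (sort_eqv A). { reflexivity. }
  all: extensionality D; apply propositional_extensionality.
  - unfold sort_eqv. split; intros (? & ? & ? & ?); repeat split; eauto.
  - unfold sort_lt, strict.
    split; intros (? & ? & ? & n); repeat split; eauto 6.
Qed.

Lemma C_family_fixpoint A t : sorts R A -> (C_family A t <-> C_condition C_family A t).
Proof.
  intros hA. set (lt := fun C => sort_lt C A). set (eqv := sort_eqv A).
  set (L := least_level lt eqv C_family).
  assert (refl : ge A A) by now apply ge_ordering.
  (* Changing [K] leaves [glue] unchanged on the smaller sorts, so the variance result gives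
     monotonicity of the operator on this class. *)
  assert (mono : forall K K', (forall C t, eqv C -> K C t -> K' C t) ->
    forall C t, eqv C -> C_condition (glue lt eqv C_family K) C t ->
      C_condition (glue lt eqv C_family K') C t).
  { intros K K' hK C u (_ & hC & h1 & h2). apply (C_condition_variance (A := A)); auto.
    - intros D v hD [n1 n2]. unfold glue, eqv, sort_eqv. tauto.
    - intros D v hD n1 n2. unfold glue. intros [?|[? ?]]; auto. }
  assert (LI : forall C u, eqv C -> C_condition (glue lt eqv C_family L) C u -> L C u).
  { intros C u hC h K hK. apply hK; auto. revert h. apply mono; auto.
    intros C' u' _ hL. now apply hL. }
  (* The operator applied to [L] is itself closed under the operator, by [LI] and [mono]; hence it
     contains the least such family [L]. *)
  assert (LE : forall C u, eqv C -> L C u -> C_condition (glue lt eqv C_family L) C u).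
  { intros C u hC h. apply (h (fun C u => C_condition (glue lt eqv C_family L) C u)).
    intros C' u' hC'. apply mono; auto. }
  assert (eqA : eqv A) by (unfold eqv, sort_eqv; auto).
  (* By [low] and [lev], the glued family agrees with [C_family] on every sort below or equivalent
     to [A], which are the only ones the condition at [A] depends on. *)
  assert (low : forall D u, sorts R D -> strict ge A D ->
     (glue lt eqv C_family L D u <-> C_family D u)).
  { intros D u hD hs. unfold glue, lt, sort_lt, eqv, sort_eqv.
    destruct hs. unfold strict. tauto. }
  assert (lev : forall D u, sorts R D -> ge A D -> ge D A ->
     (glue lt eqv C_family L D u <-> C_family D u)).
  { intros D u hD h1 h2.
    assert (eqD : eqv D) by (unfold eqv, sort_eqv; auto).
    rewrite (C_family_level eqD). fold L. unfold glue, lt, sort_lt, strict. tauto. }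
  rewrite (C_family_level eqA). fold lt eqv L. split; intros h.
  - apply LE in h; auto. revert h. apply (C_condition_variance (A := A)); auto.
    intros; now apply lev.
  - apply LI; auto. revert h. apply (C_condition_variance (A := A)); auto.
    + intros. symmetry. now apply low.
    + intros; now apply lev.
Qed.

(** A neutral term has a variable at its head, so it admits no [arg_step] and is not itself headed
    by a function symbol; the condition is then inherited from its reducts. *)
Lemma C_condition_RC_set I :
  (forall A t, sorts R A -> (I A t <-> C_condition I A t)) -> RC_set R I.
Proof.
  intros fix_I A hA. split; [|split].
  - intros t h. apply fix_I in h as (ht & sn & _); auto. split; auto. clear - sn.
    induction sn as [t _ IH]. constructor. intros u hu. apply IH. now left.
  - intros s t hs st. apply fix_I in hs as (h1 & h2 & h3); auto. apply fix_I; auto.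
    split; [eapply step_typed; eauto|split].
    + apply (Acc_inv h2). auto.
    + intros f ts h. apply h3. eapply rt_trans; eauto. now apply rt_step.
  - intros x ts ht h. apply fix_I; auto. split; [auto|split].
    + constructor. intros t' [h'|(_ & _ & f & ss & k & sk & us & E & _)].
      * apply h in h'. now apply fix_I in h' as (_ & ? & _).
      * apply (f_equal hd_of) in E. rewrite !hd_of_apps in E. discriminate.
    + intros f us hs. apply steps_inv in hs as [E|(t' & h1 & h2)].
      * apply (f_equal hd_of) in E. rewrite !hd_of_apps in E. discriminate.
      * apply h, fix_I in h1 as (_ & _ & h1); auto. now apply h1.
Qed.

Lemma C_spec : C_property R ge (C R ge).
Proof.
  apply (epsilon_spec (inhabits (fun _ _ => False)) (C_property R ge)). exists C_family. split.
  - apply C_condition_RC_set. intros; now apply C_family_fixpoint.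
  - intros. now apply C_family_fixpoint.
Qed.

Lemma C_iff A t : sorts R A -> (C R ge A t <-> C_condition (C R ge) A t).
Proof. intros hA. now apply C_spec. Qed.

(** * Reducibility properties of computable terms at all types *)

Notation comp := (comp_at R (C R ge)).

(** The three candidate conditions of Tait and Girard, proved together since termination at an arrow
    type uses the neutral-term condition of its domain. *)
Lemma comp_at_candidate T : sorts_in (sorts R) T ->
  (forall t, comp T t -> terminating (step R) t) /\
  (forall s t, comp T s -> step R s t -> comp T t) /\
  (forall x ts, typed R (apps (Var x) ts) T ->
     (forall t, step R (apps (Var x) ts) t -> comp T t) -> comp T (apps (Var x) ts)).
Proof.
  induction T as [A|T1 IH1 T2 IH2]; simpl.
  - intros hA. destruct (proj1 C_spec A hA) as (h1 & h2 & h3). split; [|split].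
    + intros t [_ h]. now apply h1.
    + intros s t [hs h] st. split; eauto using step_typed.
    + intros x ts ht h. split; auto. apply h3; auto. intros t st. now apply h.
  - intros [hT1 hT2]. destruct (IH1 hT1) as (a1 & b1 & c1), (IH2 hT2) as (a2 & b2 & c2).
    clear IH1 IH2.
    (* A variable is neutral without reducts, hence computable. Applying [t] to it yields a
       terminating term, so [t] terminates. *)
    assert (cv : comp T1 (Var (MkVar T1 0))).
    { apply (c1 _ []).
      - apply (@ht_var _ _ typ _ _ (MkVar T1 0)); auto.
      - intros t h. simpl in h. destruct (step_inv h) as [h'|(? & ? & E & _)]; [|discriminate].
        apply (root_step_head R_lcstrs) in h' as [f h']. discriminate. }
    split; [|split].
    + intros t [ht h]. apply h in cv. apply a2 in cv. clear - cv.
      remember (App t (Var (MkVar T1 0))) as u eqn:E. revert t E.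
      induction cv as [u _ IH]. intros t ->. constructor. intros t' h.
      apply (IH (App t' (Var (MkVar T1 0)))); auto. now constructor.
    + intros s t [hs h] st. split; [eapply step_typed; eauto|].
      intros u hu. apply (b2 (App s u)); auto. now constructor.
    (* A reduct of the applied neutral term reduces either the neutral part, covered by [h], or the
       argument, covered by induction on its termination. *)
    + intros x ts hx h. split; auto. intros u hu. assert (sn := a1 u hu). induction sn as [u _ IHu].
      change (comp T2 (apps (apps (Var x) ts) [u])). rewrite <- apps_cat. apply c2.
      * rewrite apps_cat. econstructor; eauto. now apply comp_at_typed in hu.
      * intros t ht. rewrite apps_cat in ht. simpl in ht.
        destruct (step_inv ht) as [h'|(s0 & s1 & [= <- <-] & [(s0' & h' & ->)|(s1' & h' & ->)])].
        -- apply (root_step_head R_lcstrs) in h' as [f h'].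
           simpl in h'. rewrite hd_of_apps in h'. discriminate.
        -- now apply h.
        -- apply IHu; auto. eapply b1; eauto.
Qed.

Lemma comp_terminating T t : comp T t -> terminating (step R) t.
Proof.
  intros h. apply (comp_at_candidate (typed_sorts R_lcstrs (comp_at_typed h))). auto.
Qed.

Lemma comp_step T s t : comp T s -> step R s t -> comp T t.
Proof.
  intros h. apply (comp_at_candidate (typed_sorts R_lcstrs (comp_at_typed h))). auto.
Qed.

Lemma comp_Var x : sorts_in (sorts R) (vty x) -> comp (vty x) (Var x).
Proof.
  intros hx. apply (proj2 (proj2 (comp_at_candidate hx)) x []).
  - now constructor.
  - intros t h. simpl in h. destruct (step_inv h) as [h'|(? & ? & E & _)]; [|discriminate].
    apply (root_step_head R_lcstrs) in h' as [f h']. discriminate.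
Qed.

Lemma comp_apps t ts Ts T :
  comp (arrs Ts T) t -> Forall2 comp Ts ts -> comp T (apps t ts).
Proof.
  intros h h2; revert t h. induction h2; simpl; auto. intros v [_ hv]. auto.
Qed.

Lemma comp_intro T t : typed R t T ->
  (forall ts, Forall2 comp (targs T) ts -> C R ge (tres T) (apps t ts)) -> comp T t.
Proof.
  revert t; induction T as [A|T1 IH1 T2 IH2]; simpl; intros t ht h; split; auto.
  - apply (h []). constructor.
  - intros u hu. apply IH2.
    + econstructor; eauto. now apply comp_at_typed in hu.
    + intros ts hts. apply (h (u :: ts)). now constructor.
Qed.

Lemma value_comp v : value R v -> exists A, comp (TSort A) v.
Proof.
  intros hv. assert (nf := value_root R_lcstrs hv). destruct hv as (f & A & -> & hf & E).
  destruct R_lcstrs as (_ & _ & _ & hth & _). apply hth in hf as [hf _].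
  apply typed_Sym in hf. rewrite E in hf. exists A. split; auto.
  apply C_iff. { apply (typed_sorts R_lcstrs hf). }
  split; [auto|split].
  - constructor. intros t [h|(_ & _ & g & ss & k & sk & us & E1 & hk & _)].
    + now apply nf in h.
    + apply (apps_Sym_inj (us := [])) in E1 as [_ <-]. destruct k; discriminate.
  - intros g ts h i ti hi. apply steps_inv in h as [E1|(t' & h & _)].
    + apply (apps_Sym_inj (us := [])) in E1 as [_ <-]. destruct i; discriminate.
    + now apply nf in h.
Qed.

(** C speaks of accessible arguments only at sorts, so the term is first saturated with variables,
    which are computable; this does not disturb position [k]. *)
Lemma comp_acc_arg T f ss k sk :
  comp T (apps (Sym (Fun f)) ss) -> nth_error ss k = Some sk -> acc_pos ge f k ->
  I_computable R (C R ge) sk.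
Proof.
  intros h hk ha. rewrite <- (arrs_targs T) in h.
  assert (hT := typed_sorts R_lcstrs (comp_at_typed h)).
  apply sorts_in_arrs in hT as [hT1 hT2].
  assert (vs : Forall2 comp (targs T) (map (fun U => Var (MkVar U 0)) (targs T))).
  { clear h. induction hT1 as [|U Us hU _ IH]; constructor; auto. now apply (@comp_Var (MkVar U 0)). }
  apply (comp_apps h) in vs. rewrite <- apps_cat in vs. destruct vs as [_ vs].
  apply C_iff in vs as (_ & _ & vs); auto.
  eapply vs; [apply rt_refl| |eauto].
  rewrite nth_error_app1; auto. apply nth_error_Some. congruence.
Qed.

Lemma args_step_comp ts ts' :
  Forall (I_computable R (C R ge)) ts -> args_step R ts ts' ->
  Forall (I_computable R (C R ge)) ts'.
Proof.
  intros h hs; induction hs; inversion h; subst; constructor; auto.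
  destruct H2 as [T hT]. exists T. eapply comp_step; eauto.
Qed.

(* Calculation steps end in values, so only a rule applied at the head can
   lead out of the computable terms. *)
Lemma head_rule_of_noncomputable f ts A :
  Forall (I_computable R (C R ge)) ts ->
  typed R (apps (Sym (Fun f)) ts) (TSort A) -> ~ C R ge A (apps (Sym (Fun f)) ts) ->
  exists ts' p sigma us,
    clos_refl_trans _ (args_step R) ts ts' /\
    rules R p /\ type_preserving R sigma /\ respects_rule R sigma p /\
    apps (Sym (Fun f)) ts' = apps (app_subst sigma (lhs p)) us /\
    ~ C R ge A (apps (app_subst sigma (rhs p)) us).
Proof.
  intros hc ht hn. apply NNPP. intros no. apply hn. clear hn.
  assert (hd : forall ts' p sigma us, clos_refl_trans _ (args_step R) ts ts' ->
    rules R p -> type_preserving R sigma -> respects_rule R sigma p ->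
    apps (Sym (Fun f)) ts' = apps (app_subst sigma (lhs p)) us ->
    C R ge A (apps (app_subst sigma (rhs p)) us)).
  { intros. apply NNPP. intros n. apply no. eauto 12. }
  clear no.
  (* The induction is on reduction of the argument list. The assumption [hd] is inherited, as it
     concerns every list reachable from [ts]. *)
  assert (acc : Acc (fun us vs => args_step R vs us) ts).
  { apply args_step_Acc. revert hc. apply Forall_impl.
    intros t [T h]. now apply comp_terminating in h. }
  assert (hA : sorts R A) by apply (typed_sorts R_lcstrs ht).
  revert hc ht hd. induction acc as [ts _ IH]. intros hc ht hd.
  assert (red : forall t, step R (apps (Sym (Fun f)) ts) t -> C R ge A t).
  { intros t h. assert (ht' := step_typed R_lcstrs ht h).
    apply step_apps_Sym in h as [(ts' & h & ->)|(us & vs & t0 & -> & h & ->)].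
    - apply IH; auto.
      + eapply args_step_comp; eauto.
      + intros. eapply hd; eauto. eapply rt_trans; eauto. now apply rt_step.
    - inversion h as [p sigma h1 h2 h3 E1 E2|g ws v' A' d h1 h2 h3 h4 h5 h6 E1 E2]; subst.
      + eapply hd; eauto; [apply rt_refl|]. now rewrite apps_cat, <- E1.
      (* The calculated prefix already has a sort as its type, so no arguments remain and the reduct
         is a value, which is computable. *)
      + rewrite E1 in h5. apply (eval_typed R_lcstrs) in h5. rewrite apps_cat in ht.
        apply has_type_apps_inv in ht as (Ts & k1 & k2).
        assert (E := typed_unique h5 k1).
        destruct Ts; [|discriminate]. inversion k2; subst. simpl in *.
        destruct (value_comp h4) as (D & hD & hC).
        assert (E' := typed_unique hD ht'). now injection E' as <-. }
  apply C_iff; auto. split; [auto|split].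
  - constructor. intros t [h|h].
    + apply red, C_iff in h as (_ & ? & _); auto.
    (* The target is a computable argument applied to computable terms, hence again in C and
       terminating for the combined relation. *)
    + destruct h as (_ & [D hD] & g & ss & k & sk & us & E & hk & -> & ha & hus).
      apply apps_Sym_inj in E as [[= <-] <-].
      rewrite Forall_forall in hc. destruct (hc sk (nth_error_In _ _ hk)) as [T hsk].
      destruct (has_type_apps_inv hD) as (Us & h1 & h2).
      rewrite (typed_unique (comp_at_typed hsk) h1) in hsk.
      assert (hu : Forall2 comp Us us).
      { clear - h2 hus. induction h2; constructor; simpl in *; auto using computable_at. }
      destruct (comp_apps hsk hu) as [_ hC].
      apply C_iff in hC as (_ & ? & _); auto. apply (typed_sorts R_lcstrs hD).
  - intros g us hs i ti hi ha. apply steps_inv in hs as [E|(t' & h1 & h2)].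
    + apply apps_Sym_inj in E as [_ <-]. rewrite Forall_forall in hc.
      apply hc. eapply nth_error_In; eauto.
    + apply red, C_iff in h1 as (_ & _ & h1); eauto.
Qed.

End Computability.

(** * Typing of fresh variables, of updated substitutions and of marked terms *)

Section FreshTyping.
Context {B F : Type} {X : B -> Type} {typ : F -> ty B} (R : lcstrs X typ).

Lemma typed_fresh_vars N As : Forall (sorts_in (sorts R)) As ->
  Forall2 (typed R) (map Var (fresh_vars N As)) As.
Proof.
  intros h; revert N. induction h as [|A As hA _ IH]; intros N; simpl; constructor; auto.
  now apply (@ht_var _ _ typ _ _ (MkVar A N)).
Qed.

Lemma fresh_vars_typed N us As : Forall2 (typed R) us As ->
  Forall2 (fun x u => typed R u (vty x)) (fresh_vars N As) us.
Proof. intros h; revert N. induction h; intros N; simpl; constructor; auto. Qed.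

Lemma upds_type_preserving sigma xs us :
  type_preserving R sigma -> Forall2 (fun x u => typed R u (vty x)) xs us ->
  type_preserving R (upds sigma xs us).
Proof.
  intros hs h. induction h as [|x u xs us hx _ IH]; simpl; auto.
  intros y hy. unfold upd. destruct excluded_middle_informative as [<-|]; auto.
Qed.

Lemma mark_typed_sharp f ss T :
  typed R (apps (Sym (Fun f)) ss) T -> defined R f ->
  typed_sharp R (apps (Sym (Mark f)) ss) (mark_ty T).
Proof.
  intros h hf. apply typed_apps_Sym_inv in h as (Ts & E & _ & hs).
  apply has_type_apps with (Ts := Ts).
  - rewrite <- mark_ty_arrs, <- E. apply (@ht_sym _ _ typ _ _ (Mark f)). eauto.
  - revert hs. apply Forall2_impl. intros t A. apply has_type_mono; auto.
    intros a (g & -> & hg). eauto.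
Qed.

End FreshTyping.

(** * From a non-computable symbol of the base system to an infinite computable chain *)

Section Extension.
Context {B F : Type} {X : B -> Type} {typ : F -> ty B} (R0 R1 : lcstrs X typ).
Variables ge ge' : sort B -> sort B -> Prop.
Hypothesis R0_lcstrs : is_lcstrs R0.
Hypothesis R0_AFP : AFP R0 ge.
Hypothesis R1_extension : extension R0 R1.
Hypothesis ge'_ordering : extends_ordering R0 R1 ge ge'.

Notation R := (union R0 R1).
Notation comp := (I_computable R (C R ge')).

Local Lemma R_lcstrs : is_lcstrs R.
Proof. apply R1_extension. Qed.

Local Lemma ge'_sort_ordering : sort_ordering (sorts R) ge'.
Proof. apply ge'_ordering. Qed.

Lemma typed_union t T : typed R0 t T -> typed R t T.
Proof.
  apply has_type_mono; simpl; auto. intros a (f & -> & hf). eauto.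
Qed.

(** Only sorts of [R0] are compared, where both orderings coincide. This transfers accessibility,
    and thereby AFP, to the combined system. *)
Lemma ge_pos_agree A T : sorts R0 A -> sorts_in (sorts R0) T ->
  (ge_pos ge A T <-> ge_pos ge' A T) /\ (gt_neg ge A T <-> gt_neg ge' A T).
Proof.
  intros hA. destruct ge'_ordering as [_ agree].
  induction T as [D|T1 IH1 T2 IH2]; simpl.
  - intros hD. unfold strict. rewrite !agree; auto. tauto.
  - intros [h1 h2]. specialize (IH1 h1). specialize (IH2 h2). tauto.
Qed.

Lemma acc_pos_agree f k :
  syms R0 f -> acc_pos (typ := typ) ge f k -> acc_pos (typ := typ) ge' f k.
Proof.
  intros hf (A & hA & hp). exists A. split; auto.
  destruct R0_lcstrs as (_ & _ & hs & _). apply hs in hf.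
  rewrite <- (arrs_targs (typ f)) in hf. apply sorts_in_arrs in hf as [h1 h2].
  rewrite Forall_forall in h1. apply ge_pos_agree; eauto using nth_error_In.
Qed.

(** Each descent of [subterm_acc] goes to an accessible argument of a symbol of [R0], and these
    inherit computability. *)
Lemma subterm_acc_comp s t T sigma :
  subterm_acc (typ := typ) ge s t -> typed R0 s T ->
  comp (app_subst sigma s) -> comp (app_subst sigma t).
Proof.
  intros h; revert T. induction h as [|f ss k sk t hk ha _ IH]; auto.
  intros T hT [U hU]. apply typed_apps_Sym_inv in hT as (Ts & _ & hf & hTs).
  destruct (Forall2_nth hTs hk) as (Tk & _ & hTk). apply (IH Tk hTk).
  rewrite app_subst_apps in hU.
  apply (comp_acc_arg R_lcstrs ge'_sort_ordering (k := k) hU).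
  - now apply map_nth_error.
  - now apply acc_pos_agree.
Qed.

Lemma apps_comp h ts T :
  comp h -> Forall comp ts -> typed R (apps h ts) T -> comp (apps h ts).
Proof.
  intros ch cts ht. exists T. destruct (has_type_apps_inv ht) as (Ts & h1 & h2).
  apply comp_apps with (Ts := Ts); [now apply computable_at|]. clear ht h1.
  induction h2; inversion cts; subst; constructor; auto using computable_at.
Qed.

(** The state maintained along the chain: a saturated non-computable call of a symbol of [R0] with
    computable arguments. *)
Definition stuck (g : F) (vs : list (term B F)) : Prop :=
  syms R0 g /\ Forall comp vs /\ exists A,
    typed R (apps (Sym (Fun g)) vs) (TSort A) /\
    ~ C R ge' A (apps (Sym (Fun g)) vs).

(** Non-computability at an arrow type is witnessed by computable further arguments [ws]; they later
    become the values of the fresh variables on the right of the dependency pair. *)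
Lemma stuck_of_noncomputable g ts T :
  syms R0 g -> Forall comp ts -> typed R (apps (Sym (Fun g)) ts) T ->
  ~ comp (apps (Sym (Fun g)) ts) ->
  exists ws, Forall2 (comp_at R (C R ge')) (targs T) ws /\ stuck g (ts ++ ws).
Proof.
  intros hg cts ht nc. apply NNPP. intros no. apply nc. exists T.
  apply comp_intro; auto. intros ws hws. apply NNPP. intros n. apply no.
  exists ws. split; auto. split; auto. split.
  - apply Forall_app. split; auto. clear - hws. induction hws; constructor; auto.
    eexists; eauto.
  - exists (tres T). rewrite apps_cat. split; auto.
    apply has_type_apps with (Ts := targs T); [now rewrite arrs_targs|].
    clear - hws. induction hws; constructor; auto. eapply comp_at_typed; eauto.
Qed.

Lemma args_steps_comp ts ts' :
  clos_refl_trans _ (args_step R) ts ts' -> Forall comp ts -> Forall comp ts'.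
Proof.
  induction 1; auto. intros h. eapply args_step_comp; eauto.
  - apply R_lcstrs.
  - apply ge'_sort_ordering.
Qed.

Lemma args_steps_steps h ts ts' :
  clos_refl_trans _ (args_step R) ts ts' -> steps R (apps h ts) (apps h ts').
Proof.
  induction 1.
  - now apply rt_step, step_apps_args.
  - apply rt_refl.
  - eapply rt_trans; eauto.
Qed.

(* No rule of R1 can be used at the head, for it would define a symbol of R0. *)
Lemma stuck_head_rule g vs : stuck g vs ->
  exists p sigma ss us A,
    clos_refl_trans _ (args_step R) vs (map (app_subst sigma) ss ++ us) /\
    rules R0 p /\ type_preserving R sigma /\ respects_rule R sigma p /\
    lhs p = apps (Sym (Fun g)) ss /\
    Forall comp (map (app_subst sigma) ss) /\ Forall comp us /\
    typed R (apps (app_subst sigma (lhs p)) us) (TSort A) /\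
    ~ C R ge' A (apps (app_subst sigma (rhs p)) us).
Proof.
  intros (hg & cvs & A & ht & nC).
  destruct (head_rule_of_noncomputable R_lcstrs ge'_sort_ordering cvs ht nC)
    as (vs' & p & sigma & us & hs & hp & h1 & h2 & E & nC').
  destruct (rule_lhs_head R_lcstrs hp) as (f & ss & El).
  assert (E' := E). rewrite El, app_subst_apps, <- apps_cat in E'. simpl in E'.
  apply apps_Sym_inj in E' as [[= <-] ->].
  assert (cvs' := args_steps_comp hs cvs). apply Forall_app in cvs' as [c1 c2].
  exists p, sigma, ss, us, A.
  refine (conj hs (conj _ (conj h1 (conj h2 (conj El (conj c1 (conj c2 (conj _ nC')))))))).
  - destruct hp as [hp|hp]; auto. exfalso.
    destruct R1_extension as (_ & _ & _ & nd). apply (nd g hg). exists p, ss. auto.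
  - rewrite <- E. apply (steps_typed R_lcstrs ht). now apply args_steps_steps.
Qed.

(** Variables of the constraint, and those absent from the left-hand side, are sent to values; AFP
    makes every other one accessible in a computable argument. *)
Lemma rhs_vars_comp p sigma g ss x :
  rules R0 p -> respects_rule R sigma p -> lhs p = apps (Sym (Fun g)) ss ->
  Forall comp (map (app_subst sigma) ss) -> fv (rhs p) x -> comp (sigma x).
Proof.
  intros hp [hv _] El css hx.
  assert (val : value R (sigma x) -> comp (sigma x)).
  { intros h. apply (value_comp R_lcstrs ge'_sort_ordering) in h as [A h]. eexists; eauto. }
  destruct (classic (fv (cstr p) x)); [apply val; auto|].
  destruct (classic (fv (lhs p) x)) as [hl|]; [|apply val; auto].
  destruct (R0_AFP hp El hl hx) as (sk & hk & ha); auto.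
  destruct R0_lcstrs as (_ & _ & _ & _ & _ & hr).
  destruct (hr _ hp) as ((A & hA & _) & _). rewrite El in hA.
  apply typed_apps_Sym_inv in hA as (Ts & _ & _ & hTs).
  destruct (Forall2_In_l hTs hk) as (Tk & _ & hTk).
  apply (subterm_acc_comp (sigma := sigma) ha hTk).
  rewrite Forall_forall in css. apply css. now apply in_map.
Qed.

(** Induction on size, descending into arguments while they have a subterm with a non-computable
    instance. When none is left, a variable head is impossible: its computable instance applied to
    computable arguments is computable. *)
Lemma minimal_noncomputable_subterm sigma t T :
  type_preserving R sigma -> typed R0 t T -> (forall x, fv t x -> comp (sigma x)) ->
  ~ comp (app_subst sigma t) ->
  exists g ts, subterm t (apps (Sym (Fun g)) ts) /\
    (forall u v, In u ts -> subterm u v -> comp (app_subst sigma v)) /\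
    ~ comp (app_subst sigma (apps (Sym (Fun g)) ts)).
Proof.
  intros hs. revert T. remember (tsize t) as n eqn:E. revert t E.
  induction n as [n IH] using (well_founded_induction lt_wf). intros t -> T ht hx nc.
  destruct (classic (exists u v, In u (args_of t) /\ subterm u v /\ ~ comp (app_subst sigma v)))
    as [(u & v & hu & hv & nv)|no].
  - assert (tv : subterm t v) by eauto using subterm_trans, args_of_subterm.
    destruct (has_type_subterm tv ht) as [V hV].
    destruct (IH (tsize v)) with (t := v) (T := V) as (g & ts & h1 & h2); auto.
    + apply args_of_tsize in hu. destruct (subterm_tsize hv) as [->|]; lia.
    + intros x h. apply hx. eapply fv_subterm; eauto.
    + exists g, ts. split; auto. eapply subterm_trans; eauto.
  - assert (args : forall u v, In u (args_of t) -> subterm u v -> comp (app_subst sigma v)).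
    { intros u v hu hv. apply NNPP. intros nv. apply no. eauto. }
    assert (cargs : Forall comp (map (app_subst sigma) (args_of t))).
    { apply Forall_forall. intros w hw. apply in_map_iff in hw as (u & <- & hu).
      apply (args u); auto. apply sub_refl. }
    destruct (hd_of_atom t) as [[x Ex]|[a Ea]].
    + exfalso. apply nc. assert (hts := typed_subst hs (typed_union ht)).
      assert (E := apps_spine t). rewrite Ex in E.
      rewrite <- E, app_subst_apps in hts |- *.
      eapply apps_comp; eauto. apply hx. rewrite <- E. apply fv_apps. now left.
    + assert (E := apps_spine t). rewrite Ea in E. destruct a as [g|g].
      * exists g, (args_of t). rewrite E. split; [apply sub_refl|auto].
      * exfalso. rewrite <- E in ht. destruct (has_type_apps_inv ht) as (Ts & h & _).
        inversion h as [|a (f & Ef & _)|]. discriminate.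
Qed.

(** Bridges the two notions of respecting: rules ask for values, dependency pairs for ground theory
    terms. *)
Lemma value_ground_theory_term v : value R v -> ground_theory_term R v.
Proof.
  intros (f & A & -> & hf & _). split; simpl; auto.
  intros a <-. eauto.
Qed.

(** The marked call [g vs] reduces to the left instance of [d], and the right instance is literally
    the marked call [g' vs'], so links with matching ends compose into a chain. *)
Definition link (g : F) (vs : list (term B F)) (d : sdp) (sigma : subst B F)
    (g' : F) (vs' : list (term B F)) : Prop :=
  SDP R0 d /\ type_preserving R sigma /\ respects_sdp R sigma d /\
  steps R (apps (Sym (Mark g)) vs) (app_subst sigma (sdp_lhs d)) /\
  app_subst sigma (sdp_rhs d) = apps (Sym (Mark g')) vs' /\
  (forall u, strict_subterm (unmark (sdp_rhs d)) u -> comp (app_subst sigma u)) /\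
  exists ss, sdp_lhs d = apps (Sym (Mark g)) ss.

Lemma stuck_link g vs : stuck g vs ->
  exists d sigma g' vs', link g vs d sigma g' vs' /\ stuck g' vs'.
Proof.
  intros hst.
  destruct (stuck_head_rule hst)
    as (p & sigma & ss & us & A & hvs & hp & tp & resp & El & css & cus & tl & nC).
  assert (xc := fun x => @rhs_vars_comp p sigma g ss x hp resp El css).
  assert (isr : is_rule R0 p) by now apply R0_lcstrs.
  destruct isr as ((T & tlhs & trhs) & _).
  destruct (has_type_apps_inv tl) as (Us & tl' & tus).
  assert (ET := typed_unique (typed_subst tp (typed_union tlhs)) tl'). subst T. clear tl'.
  destruct (fv_vid_bound (lhs p)) as [N1 b1], (fv_vid_bound (rhs p)) as [N2 b2],
    (fv_vid_bound (cstr p)) as [N3 b3].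
  (* [N] bounds all variable indices of the rule. The variables [xs] stand for the extra arguments
     [us] beyond the left-hand side, and [sigma1] sends them there. *)
  pose (N := N1 + N2 + N3). pose (xs := fresh_vars N Us).
  assert (bl : forall x, fv (lhs p) x -> vid x < N) by (intros x h; apply b1 in h; lia).
  assert (br : forall x, fv (rhs p) x -> vid x < N) by (intros x h; apply b2 in h; lia).
  assert (bc : forall x, fv (cstr p) x -> vid x < N) by (intros x h; apply b3 in h; lia).
  pose (sigma1 := upds sigma xs us).
  assert (old1 : forall x, vid x < N -> sigma1 x = sigma x).
  { intros x h. apply upds_notin. intros i%in_fresh_vars. lia. }
  assert (new1 : map sigma1 xs = us).
  { apply map_upds; [apply NoDup_fresh_vars|]. unfold xs. rewrite length_fresh_vars.
    symmetry. eapply Forall2_length; eauto. }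
  assert (tp1 : type_preserving R sigma1)
    by now apply upds_type_preserving, fresh_vars_typed.
  pose (t := apps (rhs p) (map Var xs)).
  assert (Et : app_subst sigma1 t = apps (app_subst sigma (rhs p)) us).
  { unfold t. rewrite app_subst_apps, map_app_subst_Var. rewrite new1. f_equal.
    apply app_subst_ext. auto. }
  assert (tt : typed R0 t (TSort A)).
  { apply has_type_apps with (Ts := Us); auto. apply typed_fresh_vars.
    apply typed_sorts in trhs; auto. now apply sorts_in_arrs in trhs. }
  assert (fvt : forall x, fv t x -> vid x < N \/ In x xs).
  { intros x [h|(v & hv & h)]%fv_apps; auto.
    apply in_map_iff in hv as (y & <- & hy). simpl in h. subst y. auto. }
  assert (ct : forall x, fv t x -> comp (sigma1 x)).
  { intros x [h|(v & hv & h)]%fv_apps.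
    - rewrite old1; auto.
    - apply in_map_iff in hv as (y & <- & hy). simpl in h. subst y.
      rewrite Forall_forall in cus. apply cus. rewrite <- new1. now apply in_map. }
  (* The non-computable reduct is the [sigma1] instance of the saturated right-hand side [t]; its
     minimal offending subterm supplies the right side of the dependency pair. *)
  destruct (minimal_noncomputable_subterm tp1 tt ct) as (g' & ts & hsub & hmin & nc).
  { intros h. assert (ht := typed_subst tp1 (typed_union tt)).
    apply (computable_at h) in ht. rewrite Et in ht. destruct ht. auto. }
  destruct (has_type_subterm hsub tt) as [T' tg'].
  assert (tg1 := typed_subst tp1 (typed_union tg')).
  rewrite app_subst_apps in nc, tg1. simpl in nc, tg1.
  destruct (typed_apps_Sym_inv tg') as (Ts & Eg' & hg' & hts).
  destruct (@stuck_of_noncomputable g' (map (app_subst sigma1) ts) T' hg')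
    as (ws & hws & hst'); auto.
  { apply Forall_forall. intros w (u & <- & hu)%in_map_iff.
    apply (hmin u); auto. apply sub_refl. }
  (* The new state is stuck as well, so some rule of [R0] applies at its head; this is why [g'] is a
     defined symbol. *)
  assert (dg' : defined R0 g').
  { destruct (stuck_head_rule hst') as (q & ? & ss' & ? & ? & _ & hq & _ & _ & Eq & _).
    exists q, ss'. auto. }
  (* The indices of [ys] start where those of [xs] end, so [xs ++ ys] is a single block of fresh
     variables. *)
  pose (ys := fresh_vars (N + length Us) (targs T')).
  pose (sigma2 := upds sigma1 ys ws).
  assert (old2 : forall x, vid x < N \/ In x xs -> sigma2 x = sigma1 x).
  { intros x h. apply upds_notin. intros i%in_fresh_vars.
    destruct h as [h|h%in_fresh_vars]; lia. }
  assert (new2 : map sigma2 ys = ws).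
  { apply map_upds; [apply NoDup_fresh_vars|]. unfold ys. rewrite length_fresh_vars.
    eapply Forall2_length; eauto. }
  assert (tp2 : type_preserving R sigma2).
  { apply upds_type_preserving; auto. apply fresh_vars_typed. clear - hws.
    induction hws; constructor; auto. eapply comp_at_typed; eauto. }
  assert (old : forall x, vid x < N -> sigma2 x = sigma x).
  { intros x h. rewrite old2; auto. }
  assert (fvts : forall u x, In u ts -> fv u x -> vid x < N \/ In x xs).
  { intros u x hu hx. apply fvt. apply (fv_subterm hsub). apply fv_apps. eauto. }
  exists {| sdp_lhs := apps (mark (lhs p)) (map Var xs);
            sdp_rhs := apps (Sym (Mark g')) (ts ++ map Var ys);
            sdp_cstr := cstr p;
            sdp_L := fun x => fv (cstr p) x \/ (fv (rhs p) x /\ ~ fv (lhs p) x) |},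
    sigma2, g', (map (app_subst sigma1) ts ++ ws).
  split; auto. unfold link; simpl.
  refine (conj _ (conj tp2 (conj _ (conj _ (conj _ (conj _ _)))))).
  - apply SDP_intro with (As := Us); auto.
    + rewrite El, mark_apps in *.
      replace (arrs Us (TSort SDp)) with (mark_ty (arrs Us (TSort A)))
        by (rewrite mark_ty_arrs; reflexivity).
      apply mark_typed_sharp; auto. exists p, ss. auto.
    + apply vty_fresh_vars.
    + rewrite Eg', targs_arrs, length_app, (Forall2_length hts). lia.
    + unfold ys. rewrite vty_fresh_vars, Eg', targs_arrs, (Forall2_length hts).
      rewrite skipn_app, Nat.sub_diag, skipn_all. reflexivity.
    + unfold xs, ys. rewrite <- fresh_vars_cat. apply NoDup_fresh_vars.
    + intros x. unfold xs, ys. rewrite <- fresh_vars_cat. intros h%in_fresh_vars.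
      repeat split; intros i; [apply bl in i|apply br in i|apply bc in i]; lia.
  - destruct resp as [hv he]. split; simpl.
    + intros x h. rewrite old by (destruct h as [h|[h _]]; auto).
      apply value_ground_theory_term. auto.
    + rewrite app_subst_ext with (tau := sigma); auto.
  - rewrite El, mark_apps, <- apps_cat, app_subst_apps, map_app, map_app_subst_Var.
    apply args_steps_steps. rewrite (map_ext_in sigma2 sigma1), new1 by auto.
    rewrite (map_ext_in (app_subst sigma2) (app_subst sigma)); auto.
    intros s hs. apply app_subst_ext. intros x hx. apply old, bl.
    rewrite El. apply fv_apps. eauto.
  - rewrite app_subst_apps, map_app, map_app_subst_Var. rewrite new2. do 2 f_equal.
    apply map_ext_in. intros u hu. apply app_subst_ext. eauto.
  (* A strict subterm lies in some argument: inside [ts] it is computable by minimality, and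
     otherwise it is one of [ys], sent to a computable term of [ws]. *)
  - intros u [h1 h2]. rewrite unmark_apps in *.
    apply subterm_args in h1 as [->|(v & hv & huv)]; [now destruct h2; apply sub_refl|].
    rewrite args_of_apps in hv. simpl in hv. apply in_app_or in hv as [hv|hv].
    + rewrite app_subst_ext with (tau := sigma1); eauto.
      intros x hx. apply old2. eapply fvts; eauto. eapply fv_subterm; eauto.
    + apply in_map_iff in hv as (y & <- & hy). apply subterm_args in huv as [->|(? & [] & _)].
      apply (in_map sigma2) in hy. rewrite new2 in hy.
      destruct (Forall2_In_l (R := fun w T => comp_at R (C R ge') T w)
        (Forall2_flip hws) hy) as (T & _ & hT). exists T. exact hT.
  - rewrite El, mark_apps, <- apps_cat. eauto.
Qed.

(** Dependent choice: states are packed with their proof of [stuck], so that a chosen successor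
    function can be iterated. *)
Lemma stuck_infinite_chain g vs : stuck g vs ->
  exists d sigma, infinite_chain (SDP R0) R d sigma /\ computable_chain R ge' d sigma /\
    exists ss, sdp_lhs (d 0) = apps (Sym (Mark g)) ss.
Proof.
  intros h0. pose (state := {gv : F * list (term B F) | stuck (fst gv) (snd gv)}).
  assert (next : forall s : state, {r : sdp * subst B F * state |
    link (fst (proj1_sig s)) (snd (proj1_sig s)) (fst (fst r)) (snd (fst r))
      (fst (proj1_sig (snd r))) (snd (proj1_sig (snd r)))}).
  { intros [[f us] h]. apply constructive_indefinite_description.
    destruct (stuck_link h) as (d & sigma & g' & vs' & hl & h').
    exists (d, sigma, exist _ (g', vs') h'). exact hl. }
  pose (run := fix run n : state :=
    match n with
    | 0 => exist _ (g, vs) h0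
    | S n => snd (proj1_sig (next (run n)))
    end).
  exists (fun n => fst (fst (proj1_sig (next (run n))))),
    (fun n => snd (fst (proj1_sig (next (run n))))).
  assert (links := fun n => proj2_sig (next (run n))).
  split; [|split].
  - intros n. destruct (links n) as (h1 & h2 & h3 & _ & E & _).
    refine (conj h1 (conj h2 (conj h3 _))). rewrite E. apply (links (S n)).
  - intros n u hu. now apply (links n).
  - apply (links 0).
Qed.

End Extension.

Theorem theorem33 (B F : Type) (X : B -> Type) (typ : F -> ty B)
    (R0 : lcstrs X typ) (ge : sort B -> sort B -> Prop) (H : F -> Prop)
    (R0_lcstrs : is_lcstrs R0)
    (ge_ordering : sort_ordering (sorts R0) ge)
    (R0_AFP : AFP R0 ge)
    (H_hidden : forall f, H f -> syms R0 f)
    (no_chain : forall (R1 : lcstrs X typ) (ge' : sort B -> sort B -> Prop),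
        public_extension R0 H R1 -> extends_ordering R0 R1 ge ge' ->
        ~ exists p sigma,
            infinite_chain (SDP R0) (union R0 R1) p sigma /\
            computable_chain (union R0 R1) ge' p sigma /\
            public_sdp H (p 0)) :
  publicly_computable R0 ge H.
Proof.
  intros t T ht pub R1 ge' hext hord.
  assert (ext := proj1 hext).
  (* Variables are computable and application preserves computability, so only single public symbols
     remain. *)
  induction ht as [x hx|a (f & -> & hf)|s t A1 A2 hs IHs ht IHt].
  - exists (vty x). apply comp_Var; [apply ext|apply hord|].
    revert hx. apply sorts_in_mono. simpl; auto.
  - apply NNPP. intros nc.
    (* A non-computable symbol [f] yields a stuck call of [f], whose chain starts at a dependency
       pair for [f]; as [f] is not hidden, the chain is public. *)
    destruct (@stuck_of_noncomputable _ _ _ _ R0 R1 ge' f [] (typ f))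
      as (ws & _ & hst); auto.
    { apply typed_Sym. simpl; auto. }
    destruct (stuck_infinite_chain R0_lcstrs R0_AFP ext hord hst)
      as (d & sigma & h1 & h2 & ss & h3).
    apply (no_chain R1 ge' hext hord). exists d, sigma. repeat split; try apply h1; auto.
    exists f, ss. split; auto. intros hH. apply (pub f hH). reflexivity.
  - destruct IHs as [U hU]; [intros f hf o; apply (pub f hf); now left|].
    destruct IHt as [V hV]; [intros f hf o; apply (pub f hf); now right|].
    apply (apps_comp (ts := [t]) (T := A2)).
    + now exists U.
    + repeat constructor. now exists V.
    + apply typed_union. econstructor; eauto.
Qed.
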